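(* Fair pushdown model checking for stuttering $H_\mu$ can be reduced in linear time to fair pushdown model checking for mumbling $H_\mu$, and fair finite state model checking for stuttering $H_\mu$ can be reduced in linear time to fair finite state model checking for mumbling $H_\mu$.
   Context: Fix a finite set $\mathit{AP}$. A trace is an infinite sequence $P_0m_0P_1m_1\dots$ with $P_i\subseteq\mathit{AP}$, $m_i\in\{\mathit{int},\mathit{call},\mathit{ret}\}$; $\mathit{tr}(i)=P_i$. Successor functions: $\mathit{succ}_\mathsf{g}(\mathit{tr},i)=i+1$; $\mathit{succ}_\mathsf{a}(\mathit{tr},i)=i+1$ if $m_i=\mathit{int}$, and if $m_i=\mathit{call}$ the least $j>i$ such that among $m_i,\dots,m_{j-1}$ the numbers of $\mathit{call}$ and $\mathit{ret}$ coincide (undefined if none), undefined if $m_i=\mathit{ret}$; $\mathit{succ}_\mathsf{c}(\mathit{tr},i)$ the largest $j<i$ with $m_j=\mathit{call}$ such that among $m_{j+1},\dots,m_{i-1}$ the numbers of $\mathit{call}$ and $\mathit{ret}$ coincide (undefined if none). A pushdown system is $\mathcal{PD}=(S,S_0,R,L)$ with finite $S$, $S_0\subseteq S$, $L\colon S\to2^{\mathit{AP}}$, finite stack alphabet $\Theta$, bottom $\bot\notin\Theta$, $R\subseteq(S\times S)\cup(S\times S\times\Theta)\cup(S\times\Theta\times S)$; configurations $(s,u)$, $u\in\Theta^*\bot$; $(s,u)\to_{\mathit{int}}(s',u)$ if $(s,s')\in R$, $(s,u)\to_{\mathit{call}}(s',\theta u)$ if $(s,s',\theta)\in R$, $(s,\theta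 u)\to_{\mathit{ret}}(s',u)$ if $(s,\theta,s')\in R$; paths start in $(s_0,\bot)$, $s_0\in S_0$; traces are $L(c_0)m_0L(c_1)m_1\dots$. A fair PDS $(\mathcal{PD},F)$, $F\subseteq S$, has $\mathit{Traces}(\mathcal{PD},F)$ = traces of paths visiting $F$ infinitely often. A (fair) Kripke structure is a (fair) PDS with $R\subseteq S\times S$. Mumbling $H_\mu$: trace formulae $\delta ::= \mathit{ap}\mid Y\mid\delta\lor\delta\mid\lnot\delta\mid\bigcirc^\mathsf{f}\delta\mid\mu Y.\delta$ ($\mathsf{f}\in\{\mathsf{g},\mathsf{a},\mathsf{c}\}$); multitrace formulae $\psi ::= [\delta]_\pi\mid X\mid\psi\lor\psi\mid\lnot\psi\mid\bigcirc^\Delta\psi\mid\mu X.\psi$ with $\Delta$ mapping trace variables to trace formulae; hyperproperty formulae $\varphi ::= \exists\pi.\varphi\mid\forall\pi.\varphi\mid\psi$; fixpoint variables occur positively. Trace semantics $\llbracket\delta\rrbracket^{\mathit{tr}}_{\mathcal{V}}\subseteq\mathbb{N}_0$: $\mathit{ap}\mapsto\{i\mid\mathit{ap}\in\mathit{tr}(i)\}$, $Y\mapsto\mathcal{V}(Y)$, union, complement, $\bigcirc^\mathsf{f}\delta\mapsto\{i\mid\mathit{succ}_\mathsf{f}(\mathit{tr},i)$ defined and in $\llbracket\delta\rrbracket\}$, $\mu Y.\delta\mapsto\bigcap\{I\mid\llbracket\delta\rrbracket_{\mathcal{V}[Y\mapsto I]}\subseteq I\}$. $\mathit{succ}_\delta(\mathit{tr},i)=\min\{j>i\mid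 j\in\llbracket\delta\rrbracket^{\mathit{tr}}\}$ if nonempty, else $i+1$; $\mathit{succ}_\Delta(\Pi,v)$ componentwise for trace assignment $\Pi$ on $\pi_1,\dots,\pi_n$. $\llbracket\psi\rrbracket^\Pi_{\mathcal{W}}\subseteq\mathbb{N}_0^n$: $[\delta]_{\pi_j}\mapsto\{v\mid v_j\in\llbracket\delta\rrbracket^{\Pi(\pi_j)}\}$, $X\mapsto\mathcal{W}(X)$, Boolean as usual, $\bigcirc^\Delta\psi\mapsto\{v\mid\mathit{succ}_\Delta(\Pi,v)\in\llbracket\psi\rrbracket\}$, $\mu X$ least fixpoint. $\Pi\models_\mathcal{T}\exists\pi.\varphi$ iff some $\mathit{tr}\in\mathcal{T}$ gives $\Pi[\pi\mapsto\mathit{tr}]\models_\mathcal{T}\varphi$; $\forall$ for all; $\Pi\models_\mathcal{T}\psi$ iff $(0,\dots,0)\in\llbracket\psi\rrbracket^\Pi$. For closed $\varphi$, $(\mathcal{PD},F)\models\varphi$ iff the empty assignment satisfies $\varphi$ over $\mathit{Traces}(\mathcal{PD},F)$. Stuttering $H_\mu$ is defined identically except that multitrace next operators are $\bigcirc^\Gamma\psi$, where $\Gamma$ (a stuttering assignment) maps each trace variable to a finite set of trace formulae; for a finite set $\gamma$ of trace formulae, $\mathit{succ}_\gamma(\mathit{tr},i)=\min\{j>i\mid$ for some $\delta\in\gamma$: $i\in\llbracket\delta\rrbracket^{\mathit{tr}}\not\Leftrightarrow j\in\llbracket\delta\rrbracket^{\mathit{tr}}\}$ if nonempty, else $i+1$;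 $\mathit{succ}_\Gamma$ is componentwise and $\llbracket\bigcirc^\Gamma\psi\rrbracket=\{v\mid\mathit{succ}_\Gamma(\Pi,v)\in\llbracket\psi\rrbracket\}$. Fair pushdown (resp. finite state) model checking for a logic: given a closed formula $\varphi$ and a fair PDS (resp. fair Kripke structure) $(\mathcal{PD},F)$, decide $(\mathcal{PD},F)\models\varphi$. *)

(* Defs.v *)
From Stdlib Require List.
From mathcomp Require Import all_boot.
Set Implicit Arguments.
Unset Strict Implicit.
Unset Printing Implicit Defensive.

(* Atomic propositions are natural numbers; a trace labels each position
   with a set of atomic propositions and each step with a move. *)
Inductive move := Mint | Mcall | Mret.

Record trace := Trace { tlab : nat -> nat -> bool ; tmv : nat -> move }.

Definition trace0 : trace := Trace (fun _ _ => false) (fun _ => Mint).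

Definition is_call (m : move) : bool := if m is Mcall then true else false.
Definition is_ret (m : move) : bool := if m is Mret then true else false.

Definition ncall (tr : trace) (i j : nat) : nat :=
  count is_call [seq tmv tr k | k <- iota i (j - i)].
Definition nret (tr : trace) (i j : nat) : nat :=
  count is_ret [seq tmv tr k | k <- iota i (j - i)].

Inductive flavor := Fg | Fa | Fc.

(* succ_f(tr,i) is defined and equals j *)
Definition succ_f (f : flavor) (tr : trace) (i j : nat) : Prop :=
  match f with
  | Fg => j = i.+1
  | Fa => (tmv tr i = Mint /\ j = i.+1)
          \/ (tmv tr i = Mcall /\ i < j /\ ncall tr i j = nret tr i j /\
              forall k, i < k -> k < j -> ncall tr i k <> nret tr i k)
  | Fc => j < i /\ tmv tr j = Mcall /\ ncall tr j.+1 i = nret tr j.+1 i /\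
          forall k, j < k -> k < i ->
            ~ (tmv tr k = Mcall /\ ncall tr k.+1 i = nret tr k.+1 i)
  end.

Definition succ_set (S : nat -> Prop) (i k : nat) : Prop :=
  (i < k /\ S k /\ forall m, i < m -> m < k -> ~ S m)
  \/ ((forall m, i < m -> ~ S m) /\ k = i.+1).

Inductive tform :=
  | tap of nat
  | tvar of nat
  | tor of tform & tform
  | tneg of tform
  | tnext of flavor & tform
  | tmu of nat & tform.

Definition upd {A : Type} (V : nat -> A) (x : nat) (a : A) : nat -> A :=
  fun y => if y == x then a else V y.

Fixpoint tsem (tr : trace) (V : nat -> nat -> Prop) (d : tform) : nat -> Prop :=
  match d with
  | tap a => fun i => tlab tr i a
  | tvar Y => V Y
  | tor d1 d2 => fun i => tsem tr V d1 i \/ tsem tr V d2 i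
  | tneg d1 => fun i => ~ tsem tr V d1 i
  | tnext f d1 => fun i => exists j, succ_f f tr i j /\ tsem tr V d1 j
  | tmu Y d1 => fun i => forall I : nat -> Prop,
                  (forall k, tsem tr (upd V Y I) d1 k -> I k) -> I i
  end.

Definition V0 : nat -> nat -> Prop := fun _ _ => False.

Fixpoint t_pol (p : bool) (Y : nat) (d : tform) : bool :=
  match d with
  | tap _ => true
  | tvar Y' => (Y' != Y) || p
  | tor d1 d2 => t_pol p Y d1 && t_pol p Y d2
  | tneg d1 => t_pol (~~ p) Y d1
  | tnext _ d1 => t_pol p Y d1
  | tmu Y' d1 => (Y' == Y) || t_pol p Y d1
  end.

Fixpoint twf (bnd : seq nat) (d : tform) : bool :=
  match d with
  | tap _ => true
  | tvar Y => Y \in bnd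
  | tor d1 d2 => twf bnd d1 && twf bnd d2
  | tneg d1 => twf bnd d1
  | tnext _ d1 => twf bnd d1
  | tmu Y d1 => t_pol true Y d1 && twf (Y :: bnd) d1
  end.

Definition tdefault : tform := tap 0.

Definition succ_del (tr : trace) (d : tform) (i k : nat) : Prop :=
  succ_set (tsem tr V0 d) i k.
Definition succ_gam (tr : trace) (g : seq tform) (i k : nat) : Prop :=
  succ_set (fun j => exists2 d, List.In d g & ~ (tsem tr V0 d i <-> tsem tr V0 d j)) i k.

(* Multitrace formulae. Trace variables are numbered by the position   *)
(* of their quantifier in the prefix (0 = outermost).                   *)
Inductive mform :=
  | matom of nat & tform
  | mvar of nat
  | mor of mform & mform
  | mneg of mform
  | mnext of seq tform & mform    (* Delta: j-th entry = Delta(pi_j) *)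
  | mmu of nat & mform.

Inductive sform :=
  | satom of nat & tform
  | svar of nat
  | sor of sform & sform
  | sneg of sform
  | snext of seq (seq tform) & sform  (* Gamma: j-th entry = Gamma(pi_j) *)
  | smu of nat & sform.

Definition mvec (n : nat) := 'I_n -> nat.

Fixpoint msem (n : nat) (P : 'I_n -> trace) (W : nat -> mvec n -> Prop)
    (psi : mform) : mvec n -> Prop :=
  match psi with
  | matom j d => fun v => exists j' : 'I_n, nat_of_ord j' = j /\ tsem (P j') V0 d (v j')
  | mvar X => W X
  | mor a b => fun v => msem P W a v \/ msem P W b v
  | mneg a => fun v => ~ msem P W a v
  | mnext D a => fun v => exists w : mvec n,
        (forall j : 'I_n, succ_del (P j) (nth tdefault D j) (v j) (w j)) /\ msem P W a w
  | mmu X a => fun v => forall I : mvec n -> Prop,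
        (forall u, msem P (upd W X I) a u -> I u) -> I v
  end.

Fixpoint ssem (n : nat) (P : 'I_n -> trace) (W : nat -> mvec n -> Prop)
    (psi : sform) : mvec n -> Prop :=
  match psi with
  | satom j d => fun v => exists j' : 'I_n, nat_of_ord j' = j /\ tsem (P j') V0 d (v j')
  | svar X => W X
  | sor a b => fun v => ssem P W a v \/ ssem P W b v
  | sneg a => fun v => ~ ssem P W a v
  | snext G a => fun v => exists w : mvec n,
        (forall j : 'I_n, succ_gam (P j) (nth [::] G j) (v j) (w j)) /\ ssem P W a w
  | smu X a => fun v => forall I : mvec n -> Prop,
        (forall u, ssem P (upd W X I) a u -> I u) -> I v
  end.

Fixpoint m_pol (p : bool) (X : nat) (psi : mform) : bool :=
  match psi with
  | matom _ _ => true
  | mvar X' => (X' != X) || p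
  | mor a b => m_pol p X a && m_pol p X b
  | mneg a => m_pol (~~ p) X a
  | mnext _ a => m_pol p X a
  | mmu X' a => (X' == X) || m_pol p X a
  end.

Fixpoint s_pol (p : bool) (X : nat) (psi : sform) : bool :=
  match psi with
  | satom _ _ => true
  | svar X' => (X' != X) || p
  | sor a b => s_pol p X a && s_pol p X b
  | sneg a => s_pol (~~ p) X a
  | snext _ a => s_pol p X a
  | smu X' a => (X' == X) || s_pol p X a
  end.

Fixpoint mwf (n : nat) (bnd : seq nat) (psi : mform) : bool :=
  match psi with
  | matom j d => (j < n) && twf [::] d
  | mvar X => X \in bnd
  | mor a b => mwf n bnd a && mwf n bnd b
  | mneg a => mwf n bnd a
  | mnext D a => (size D == n) && all (twf [::]) D && mwf n bnd a
  | mmu X a => m_pol true X a && mwf n (X :: bnd) a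
  end.

Fixpoint swf (n : nat) (bnd : seq nat) (psi : sform) : bool :=
  match psi with
  | satom j d => (j < n) && twf [::] d
  | svar X => X \in bnd
  | sor a b => swf n bnd a && swf n bnd b
  | sneg a => swf n bnd a
  | snext G a => (size G == n) && all (all (twf [::])) G && swf n bnd a
  | smu X a => s_pol true X a && swf n (X :: bnd) a
  end.

(* Hyperproperty formulae: a quantifier prefix (true = exists, false = forall)
   followed by a multitrace formula. *)
Definition mhyp := (seq bool * mform)%type.
Definition shyp := (seq bool * sform)%type.

Definition mhyp_closed (phi : mhyp) : bool := mwf (size phi.1) [::] phi.2.
Definition shyp_closed (phi : shyp) : bool := swf (size phi.1) [::] phi.2.

Fixpoint satq (T : trace -> Prop) (qs : seq bool) (k : nat) (P : nat -> trace)
    (final : (nat -> trace) -> Prop) : Prop :=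
  match qs with
  | [::] => final P
  | b :: qs' =>
      if b then exists tr, T tr /\ satq T qs' k.+1 (upd P k tr) final
      else forall tr, T tr -> satq T qs' k.+1 (upd P k tr) final
  end.

Definition mhyp_sat (T : trace -> Prop) (phi : mhyp) : Prop :=
  satq T phi.1 0 (fun _ => trace0)
    (fun P => msem (fun j : 'I_(size phi.1) => P j) (fun _ _ => False) phi.2
                   (fun _ => 0)).

Definition shyp_sat (T : trace -> Prop) (phi : shyp) : Prop :=
  satq T phi.1 0 (fun _ => trace0)
    (fun P => ssem (fun j : 'I_(size phi.1) => P j) (fun _ _ => False) phi.2
                   (fun _ => 0)).

(* States are 0..nst-1, stack symbols 0..nstk-1; the bottom symbol is the
   end of the stack list.  pcall: (s, s', theta); pret: (s, theta, s');
   plab: label of state s is nth [::] plab s; pfair = F. *)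
Record pds := Pds {
  nst : nat; nstk : nat;
  pinit : seq nat;
  pint : seq (nat * nat);
  pcall : seq (nat * nat * nat);
  pret : seq (nat * nat * nat);
  plab : seq (seq nat);
  pfair : seq nat }.

Definition wf_pds (P : pds) : bool :=
  all (fun s => s < nst P) (pinit P) &&
  all (fun r => (r.1 < nst P) && (r.2 < nst P)) (pint P) &&
  all (fun r => (r.1.1 < nst P) && (r.1.2 < nst P) && (r.2 < nstk P)) (pcall P) &&
  all (fun r => (r.1.1 < nst P) && (r.1.2 < nstk P) && (r.2 < nst P)) (pret P) &&
  (size (plab P) == nst P) &&
  all (fun s => s < nst P) (pfair P).

Definition is_kripke (P : pds) : bool := (pcall P == [::]) && (pret P == [::]).

Definition config := (nat * seq nat)%type.

Definition pstep (P : pds) (c : config) (m : move) (c' : config) : Prop :=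
  match m with
  | Mint => (c.1, c'.1) \in pint P /\ c'.2 = c.2
  | Mcall => exists th, (c.1, c'.1, th) \in pcall P /\ c'.2 = th :: c.2
  | Mret => exists th, (c.1, th, c'.1) \in pret P /\ c.2 = th :: c'.2
  end.

Definition fair_trace (P : pds) (tr : trace) : Prop :=
  exists c : nat -> config,
    (c 0).1 \in pinit P /\ (c 0).2 = [::] /\
    (forall i, pstep P (c i) (tmv tr i) (c i.+1)) /\
    (forall k, exists2 i, k <= i & (c i).1 \in pfair P) /\
    (forall i a, tlab tr i a = (a \in nth [::] (plab P) (c i).1)).

Definition sinst := (shyp * pds)%type.
Definition minst := (mhyp * pds)%type.

Definition sinst_valid (x : sinst) : bool := shyp_closed x.1 && wf_pds x.2.
Definition minst_valid (y : minst) : bool := mhyp_closed y.1 && wf_pds y.2.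

Definition sinst_holds (x : sinst) : Prop := shyp_sat (fair_trace x.2) x.1.
Definition minst_holds (y : minst) : Prop := mhyp_sat (fair_trace y.2) y.1.

Fixpoint bits_fuel (f n : nat) : seq nat :=
  match f with
  | 0 => [::]
  | f'.+1 => if n == 0 then [::] else (odd n).+1 :: bits_fuel f' n./2
  end.
(* binary (little endian, digits 1/2) terminated by 3 *)
Definition enc_nat (n : nat) : seq nat := bits_fuel n n ++ [:: 3].

Definition enc_list {A} (e : A -> seq nat) (s : seq A) : seq nat :=
  19 :: flatten (map e s) ++ [:: 20].

Definition enc_flavor (f : flavor) : seq nat :=
  match f with Fg => [:: 9] | Fa => [:: 10] | Fc => [:: 11] end.

Fixpoint enc_t (d : tform) : seq nat :=
  match d with
  | tap a => 4 :: enc_nat a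
  | tvar Y => 5 :: enc_nat Y
  | tor a b => 6 :: enc_t a ++ enc_t b
  | tneg a => 7 :: enc_t a
  | tnext f a => 8 :: enc_flavor f ++ enc_t a
  | tmu Y a => 12 :: enc_nat Y ++ enc_t a
  end.

Fixpoint enc_m (psi : mform) : seq nat :=
  match psi with
  | matom j d => 13 :: enc_nat j ++ enc_t d
  | mvar X => 14 :: enc_nat X
  | mor a b => 15 :: enc_m a ++ enc_m b
  | mneg a => 16 :: enc_m a
  | mnext D a => 17 :: enc_list enc_t D ++ enc_m a
  | mmu X a => 18 :: enc_nat X ++ enc_m a
  end.

Fixpoint enc_s (psi : sform) : seq nat :=
  match psi with
  | satom j d => 13 :: enc_nat j ++ enc_t d
  | svar X => 14 :: enc_nat X
  | sor a b => 15 :: enc_s a ++ enc_s b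
  | sneg a => 16 :: enc_s a
  | snext G a => 17 :: enc_list (enc_list enc_t) G ++ enc_s a
  | smu X a => 18 :: enc_nat X ++ enc_s a
  end.

Definition enc_quants (qs : seq bool) : seq nat :=
  [seq (if b then 21 else 22) | b <- qs] ++ [:: 23].

Definition enc_pair (p : nat * nat) : seq nat := enc_nat p.1 ++ enc_nat p.2.
Definition enc_triple (p : nat * nat * nat) : seq nat :=
  enc_nat p.1.1 ++ enc_nat p.1.2 ++ enc_nat p.2.

Definition enc_pds (P : pds) : seq nat :=
  24 :: enc_nat (nst P) ++ enc_nat (nstk P) ++ enc_list enc_nat (pinit P)
     ++ enc_list enc_pair (pint P) ++ enc_list enc_triple (pcall P)
     ++ enc_list enc_triple (pret P) ++ enc_list (enc_list enc_nat) (plab P)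
     ++ enc_list enc_nat (pfair P).

Definition enc_sinst (x : sinst) : seq nat :=
  enc_quants x.1.1 ++ enc_s x.1.2 ++ enc_pds x.2.
Definition enc_minst (y : minst) : seq nat :=
  enc_quants y.1.1 ++ enc_m y.1.2 ++ enc_pds y.2.

Definition enc_alphabet : nat := 25. (* encodings use symbols 1..24 *)

Inductive dir := DL | DR | DS.

Definition tape := (seq nat * nat * seq nat)%type.  (* reversed left part, head, right part *)

Definition blank_tape : tape := ([::], 0, [::]).

Definition move_tape (t : tape) (d : dir) : tape :=
  let: (l, h, r) := t in
  match d with
  | DL => match l with [::] => ([::], 0, h :: r) | x :: l' => (l', x, h :: r) end
  | DR => match r with [::] => (h :: l, 0, [::]) | x :: r' => (h :: l, x, r') end
  | DS => t
  end.

Definition write_tape (t : tape) (w : nat) : tape :=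
  let: (l, _, r) := t in (l, w, r).

Record TM := Tm {
  tm_tapes : nat;
  tm_states : nat;               (* states 0..Q-1, initial state 0 *)
  tm_syms : nat;                 (* tape alphabet 0..S-1, 0 = blank *)
  (* transition: state, symbols under the k heads |-> None (halt) or
     new state, k symbols to write, k head moves *)
  tm_delta : nat -> seq nat -> option (nat * seq nat * seq dir) }.

Definition wf_TM (M : TM) : Prop :=
  0 < tm_tapes M /\ 0 < tm_states M /\ enc_alphabet <= tm_syms M /\
  forall q rs q' ws ds,
    q < tm_states M -> size rs = tm_tapes M -> all (fun a => a < tm_syms M) rs ->
    tm_delta M q rs = Some (q', ws, ds) ->
    [/\ q' < tm_states M, size ws = tm_tapes M, size ds = tm_tapes M
      & all (fun a => a < tm_syms M) ws].

Definition tm_config := (nat * seq tape)%type.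

Definition tm_init (M : TM) (x : seq nat) : tm_config :=
  (0, ([::], head 0 x, behead x) :: nseq (tm_tapes M).-1 blank_tape).

Definition tm_step (M : TM) (c : tm_config) : option tm_config :=
  let: (q, ts) := c in
  match tm_delta M q [seq t.1.2 | t <- ts] with
  | None => None
  | Some (q', ws, ds) =>
      Some (q', [seq move_tape (write_tape p.1 p.2.1) p.2.2 | p <- zip ts (zip ws ds)])
  end.

Fixpoint tm_run (M : TM) (t : nat) (c : tm_config) : option tm_config :=
  match t with
  | 0 => Some c
  | t'.+1 => match tm_step M c with None => None | Some c' => tm_run M t' c' end
  end.

Fixpoint drop_blanks (s : seq nat) : seq nat :=
  match s with [::] => [::] | a :: s' => if a == 0 then drop_blanks s' else s end.

Definition tape_contents (t : tape) : seq nat :=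
  let: (l, h, r) := t in rev (drop_blanks (rev (drop_blanks (rev l ++ h :: r)))).

Definition tm_output (c : tm_config) : seq nat := tape_contents (last blank_tape c.2).

Definition tm_computes_in (M : TM) (x : seq nat) (t : nat) (y : seq nat) : Prop :=
  exists c, tm_run M t (tm_init M x) = Some c /\ tm_step M c = None /\ tm_output c = y.

Definition lin_time_reduction (pre : sinst -> Prop) (post : minst -> Prop) : Prop :=
  exists (M : TM) (c : nat), wf_TM M /\
    forall x : sinst, sinst_valid x -> pre x ->
      exists (t : nat) (y : minst),
        t <= c * size (enc_sinst x) + c /\
        tm_computes_in M (enc_sinst x) t (enc_minst y) /\
        minst_valid y /\ post y /\
        (sinst_holds x <-> minst_holds y).

(* Main.v *)
Require Import Defs.
From mathcomp Require Import all_boot.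
From HB Require Import structures.
From mathcomp Require Import zify.
From Stdlib Require Import Classical FunctionalExtensionality.
From Stdlib Require List.
Set Implicit Arguments.
Unset Strict Implicit.
Unset Printing Implicit Defensive.

(** Split every position [i] of a trace into a marker position [2i] and a copy
    [2i+1] that carries the label and the move of [i].  Whether some formula of
    [gamma] changes its truth value between [i] and [i+1] can be seen by looking
    forward from the copy of [i].  So the stuttering successor of [i] is reached
    from the marker of [i] by two mumbling steps: first to the earliest copy
    [2k+1] with [k >= i] at which a change is ahead (starting at the marker makes
    [k = i] possible), then to the next marker [2(k+1)].  If no change is ahead,
    the two default steps lead to the marker of [i+1].  Pushdown systems are
    split in the same way, state [s] becoming [2s] and [2s+1].

    The translation copies every trace formula of an assignment four times and
    every state of a transition a bounded number of times, so it is linear, and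
    it is computed by a multitape machine.  That machine is given as a structured
    program whose finitely many residuals serve as machine states. *)

(** The obstacle is that a mumbling step judges a candidate [j] alone, whereas a stuttering step
    compares [j] with its origin [i]. Before the first difference nothing in [gamma] has changed, so
    the comparison with [i] can be replaced by one between neighbours. Trace formulae have no
    modality for the preceding position, so the change must be tested one position early; but a
    successor strictly greater than [i] cannot stop at [i] itself. Doubling the positions removes
    this off-by-one. Proposition [0] marks the added positions and [a] becomes [a.*2.+1], so the two
    never clash. In the little-endian code this renaming, like that of the states, prepends at most
    one digit and can be done while reading. Trace formulae contain no assignments, so the fourfold
    duplication is never nested and costs a constant factor only. *)

Definition dbl_trace (tr : trace) : trace :=
  Trace (fun i a => if odd i then odd a && tlab tr i./2 a./2 else a == 0)
        (fun i => if odd i then tmv tr i./2 else Mint).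

(** Meant to be evaluated at copies. From a copy, the [Fg] and [Fa] successors are markers, so one
    more step is needed to reach a copy again. The caller is a position with a call move, hence
    already a copy, and [Fc] needs no correction. *)
Fixpoint dbl_t (d : tform) : tform :=
  match d with
  | tap a => tap a.*2.+1
  | tvar Y => tvar Y
  | tor d1 d2 => tor (dbl_t d1) (dbl_t d2)
  | tneg d1 => tneg (dbl_t d1)
  | tnext Fc d1 => tnext Fc (dbl_t d1)
  | tnext f d1 => tnext f (tnext Fg (dbl_t d1))
  | tmu Y d1 => tmu Y (dbl_t d1)
  end.

(** An exclusive or, spelled out with disjunction and negation; this is where the four copies come
    from. Two [Fg] steps lead from a copy to the next copy. *)
Definition change_t (d : tform) : tform :=
  tor (tneg (tor (dbl_t d) (tneg (tnext Fg (tnext Fg (dbl_t d))))))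
      (tneg (tor (tneg (dbl_t d)) (tnext Fg (tnext Fg (dbl_t d))))).

(* The marker [tap 0] is false at odd positions, so it also serves as the
   empty disjunction there. *)
Definition stutter_t (g : seq tform) : tform :=
  tneg (tor (tap 0) (tneg (foldr (fun d e => tor (change_t d) e) (tap 0) g))).

(** Multitrace formulae are evaluated at vectors of markers, so an atom first steps to the copy that
    carries the label. *)
Fixpoint dbl_m (psi : sform) : mform :=
  match psi with
  | satom j d => matom j (tnext Fg (dbl_t d))
  | svar X => mvar X
  | sor a b => mor (dbl_m a) (dbl_m b)
  | sneg a => mneg (dbl_m a)
  | snext G a => mnext (map stutter_t G) (mnext (nseq (size G) (tap 0)) (dbl_m a))
  | smu X a => mmu X (dbl_m a)
  end.

Definition src_edge (s : nat) : nat * nat := (s.*2, s.*2.+1).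

(** The edge from a marker to its copy is added once per outgoing transition instead of once per
    state. Naming all [n] states would take about [n] times [log n] symbols, which is not linear for
    a system with few transitions, whereas a transition already names its source. States without
    outgoing transitions lie on no infinite path. *)
Definition dbl_pds (P : pds) : pds :=
  Pds (nst P).*2 (nstk P) (map double (pinit P))
    (flatten [seq [:: src_edge r.1; (r.1.*2.+1, r.2.*2)] | r <- pint P]
     ++ [seq src_edge r.1.1 | r <- pcall P] ++ [seq src_edge r.1.1 | r <- pret P])
    [seq (r.1.1.*2.+1, r.1.2.*2, r.2) | r <- pcall P]
    [seq (r.1.1.*2.+1, r.1.2, r.2.*2) | r <- pret P]
    (flatten [seq [:: [:: 0]; [seq a.*2.+1 | a <- l]] | l <- plab P])
    [seq s.*2.+1 | s <- pfair P].

Definition dbl_inst (x : sinst) : minst := ((x.1.1, dbl_m x.1.2), dbl_pds x.2).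

(** * Trace formulae on doubled traces *)

(** Markers carry [Mint] and are not counted, and the copy of [k] lies in the interval from [i] to
    [j] exactly when [i./2 <= k < j./2], whatever the parities of [i] and [j]. *)
Lemma count_dbl_trace (p : move -> bool) tr i j : p Mint = false ->
  count p [seq tmv (dbl_trace tr) k | k <- iota i (j - i)] =
  count p [seq tmv tr k | k <- iota i./2 (j./2 - i./2)].
Proof.
move=> p0; have [le_ij|lt_ji] := leqP i j; last first.
  have -> : j - i = 0 by lia.
  by have -> : j./2 - i./2 = 0 by lia.
rewrite -(subnKC le_ij) addKn; elim: (j - i) => [|n IH].
  by rewrite addn0 subnn.
rewrite -addn1 iotaD map_cat count_cat {}IH addn1 addnS /=.
have [o|e] := boolP (odd (i + n)).
  have -> : uphalf (i + n) - i./2 = ((i + n)./2 - i./2) + 1 by lia.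
  rewrite iotaD map_cat count_cat /=.
  by have -> : i./2 + ((i + n)./2 - i./2) = (i + n)./2 by lia.
have -> : uphalf (i + n) = (i + n)./2 by lia.
by rewrite p0 !addn0.
Qed.

Lemma ncall_dbl_trace tr i j : ncall (dbl_trace tr) i j = ncall tr i./2 j./2.
Proof. exact: count_dbl_trace. Qed.

Lemma nret_dbl_trace tr i j : nret (dbl_trace tr) i j = nret tr i./2 j./2.
Proof. exact: count_dbl_trace. Qed.

Lemma succ_a_dbl_trace tr i j :
  succ_f Fa (dbl_trace tr) i.*2.+1 j <-> exists2 k, j = k.*2 & succ_f Fa tr i k.
Proof.
rewrite /= odd_double /= uphalf_double; split.
- case=> [[mi ->]|[mi [lt_ij []]]]; first by exists i.+1; [rewrite doubleS|left].
  rewrite ncall_dbl_trace nret_dbl_trace /= uphalf_double => eq_ij min_j.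
  (* An odd [j] is never minimal: the marker [j.-1] before it is already balanced. *)
  have [oj|ej] := boolP (odd j).
    case: (min_j j.-1); [lia|lia|].
    rewrite ncall_dbl_trace nret_dbl_trace /= uphalf_double.
    by have -> : j.-1./2 = j./2 by lia.
  exists j./2; first lia.
  right; split=> //; split; first lia; split=> // k lt_ik lt_kj.
  have := min_j k.*2; rewrite ncall_dbl_trace nret_dbl_trace /= uphalf_double.
  by rewrite doubleK; apply; lia.
case=> k -> [[mi ->]|[mi [lt_ik [eq_ik min_k]]]].
  by left; split=> //; rewrite doubleS.
right; split=> //; split; first lia.
rewrite ncall_dbl_trace nret_dbl_trace /= uphalf_double doubleK; split=> // l il lk.
rewrite ncall_dbl_trace nret_dbl_trace /= uphalf_double.
by apply: min_k; lia.
Qed.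

Lemma succ_c_dbl_trace tr i j :
  succ_f Fc (dbl_trace tr) i.*2.+1 j <-> exists2 k, j = k.*2.+1 & succ_f Fc tr i k.
Proof.
rewrite /=; split.
- case=> lt_ji []; case: ifP => // oj mj.
  rewrite ncall_dbl_trace nret_dbl_trace /= uphalf_double => -[eq_ji max_j].
  exists j./2; first lia.
  have ej : uphalf j = j./2.+1 by lia.
  rewrite ej in eq_ji; split; first lia; split=> //; split=> // k jk ki [mk eq_k].
  apply: (max_j k.*2.+1); [lia|lia|].
  rewrite ncall_dbl_trace nret_dbl_trace /= odd_double /= !uphalf_double ?doubleK.
  by split.
case=> k -> [lt_ki [mk [eq_ki max_k]]]; split; first lia.
rewrite ncall_dbl_trace nret_dbl_trace /= odd_double /= !uphalf_double ?doubleK.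
split=> //; split=> // l kl li []; case: ifP => // ol ml.
rewrite ncall_dbl_trace nret_dbl_trace /= uphalf_double => eq_l.
have el : uphalf l = l./2.+1 by lia.
rewrite el in eq_l.
by apply: (max_k l./2); [lia|lia|].
Qed.

Lemma tsem_or tr V d1 d2 i :
  tsem tr V (tor d1 d2) i <-> tsem tr V d1 i \/ tsem tr V d2 i.
Proof. by []. Qed.

Lemma tsem_neg tr V d i : tsem tr V (tneg d) i <-> ~ tsem tr V d i.
Proof. by []. Qed.

Lemma tsem_next tr V f d i :
  tsem tr V (tnext f d) i <-> exists2 j, succ_f f tr i j & tsem tr V d j.
Proof. by split=> [[j []]|[j]]; exists j. Qed.

Lemma tsem_nextg tr V d i : tsem tr V (tnext Fg d) i <-> tsem tr V d i.+1.
Proof. by rewrite tsem_next; split=> [[_ ->]|]; [|exists i.+1]. Qed.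

Lemma tsem_mu tr V Y d i : tsem tr V (tmu Y d) i <->
  forall I : nat -> Prop, (forall k, tsem tr (upd V Y I) d k -> I k) -> I i.
Proof. by []. Qed.

(** The valuations are related at copies only. This freedom at markers is what lets the induction
    pass through fixpoints, whose approximants on the doubled trace may contain arbitrary
    markers. *)
Lemma tsem_dbl tr d : forall V V', (forall Y i, V' Y i.*2.+1 <-> V Y i) ->
  forall i, tsem (dbl_trace tr) V' (dbl_t d) i.*2.+1 <-> tsem tr V d i.
Proof.
elim: d => [a|Y|d1 IH1 d2 IH2|d IH|f d IH|Y d IH] V V' VV' i.
- by rewrite /= !odd_double /= !uphalf_double.
- exact: VV'.
- by rewrite /= (IH1 V V' VV') (IH2 V V' VV').
- by rewrite /= (IH V V' VV').
- case: f.
  + by rewrite !tsem_nextg -doubleS (IH V V' VV').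
  + rewrite !tsem_next; split=> [[j /succ_a_dbl_trace[k -> ik]]|[k ik H]].
      by rewrite tsem_nextg (IH V V' VV'); exists k.
    exists k.*2; first by apply/succ_a_dbl_trace; exists k.
    by rewrite tsem_nextg (IH V V' VV').
  + rewrite !tsem_next; split=> [[j /succ_c_dbl_trace[k -> ik]]|[k ik H]].
      by rewrite (IH V V' VV'); exists k.
    exists k.*2.+1; first by apply/succ_c_dbl_trace; exists k.
    by rewrite (IH V V' VV').
- rewrite !tsem_mu; split=> H I clI.
    (* [J] contains every marker, so its closure has to be checked at copies only. *)
    pose J k := odd k -> I k./2.
    have VJ Z j : upd V' Y J Z j.*2.+1 <-> upd V Y I Z j.
      rewrite /upd /J; case: eqP => _ //=.
      by rewrite odd_double uphalf_double; split=> H'; [apply: H'|].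
    have : J i.*2.+1.
      apply: H => k Hk ok; apply: clI; rewrite -(IH _ _ VJ).
      by have -> : k./2.*2.+1 = k by lia.
    by rewrite /J /= odd_double uphalf_double; apply.
  apply: (H (fun k => I k.*2.+1)) => k Hk; apply: clI.
  by apply/(IH (upd V Y (fun k => I k.*2.+1))) => // Z j; rewrite /upd; case: eqP.
Qed.

Lemma tsem_dbl0 tr d i : tsem (dbl_trace tr) V0 (dbl_t d) i.*2.+1 <-> tsem tr V0 d i.
Proof. exact: tsem_dbl. Qed.

(** * Simulating stuttering successors by two mumbling steps *)

Definition changes tr (g : seq tform) (i : nat) : Prop :=
  exists2 d, List.In d g & ~ (tsem tr V0 d i <-> tsem tr V0 d i.+1).

Lemma tsem_change tr d i :
  tsem (dbl_trace tr) V0 (change_t d) i.*2.+1 <->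
  ~ (tsem tr V0 d i <-> tsem tr V0 d i.+1).
Proof.
(* [tauto] is classical here: splitting a failed equivalence into a disjunction requires excluded
   middle. *)
rewrite /change_t !(tsem_or, tsem_neg) !tsem_nextg -doubleS !tsem_dbl0; tauto.
Qed.

Lemma tsem_stutter_odd tr g i :
  tsem (dbl_trace tr) V0 (stutter_t g) i.*2.+1 <-> changes tr g i.
Proof.
have foldE : tsem (dbl_trace tr) V0
    (foldr (fun d e => tor (change_t d) e) (tap 0) g) i.*2.+1 <-> changes tr g i.
  elim: g => [|d g IH].
    by rewrite /= odd_double /=; split=> // -[].
  rewrite [foldr _ _ _]/= tsem_or IH tsem_change; split.
    case=> [H|[e eg H]]; first by exists d => //; left.
    by exists e => //; right.
  by case=> e [<-|eg] H; [left|right; exists e].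
rewrite -foldE {foldE} /stutter_t !(tsem_or, tsem_neg) {1}/tsem [tlab _ _ _]/= odd_double.
split=> [H|H []] //; apply: NNPP => H'; apply: H; by right.
Qed.

(** The marker disjunct under the negation keeps the first mumbling step from being attracted by
    markers, where the translated formulae have no meaning. *)
Lemma tsem_stutter_even tr g i : ~ tsem (dbl_trace tr) V0 (stutter_t g) i.*2.
Proof. by rewrite /= odd_double /= => H; apply: H; left. Qed.

Lemma stutter_oddP tr g i :
  tsem (dbl_trace tr) V0 (stutter_t g) i <-> odd i /\ changes tr g i./2.
Proof.
have [oi|ei] := boolP (odd i).
  rewrite -tsem_stutter_odd; have -> : i./2.*2.+1 = i by lia.
  by split=> [|[]].
split=> [|[]] //; have -> : i = i./2.*2 by lia.
by move/tsem_stutter_even.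
Qed.

Lemma no_change_const tr g i k d : i <= k -> List.In d g ->
  (forall m, i <= m -> m < k -> ~ changes tr g m) ->
  tsem tr V0 d i <-> tsem tr V0 d k.
Proof.
move=> le_ik dg; rewrite -(subnKC le_ik); elim: (k - i) => [|n IH] H.
  by rewrite addn0.
rewrite IH; last by move=> m im mn; apply: H; lia.
apply: NNPP => H'; apply: (H (i + n)); [lia|lia|].
by exists d => //; rewrite -addnS.
Qed.

Definition differs tr g i j :=
  exists2 d, List.In d g & ~ (tsem tr V0 d i <-> tsem tr V0 d j).

(** Up to the first difference every formula keeps its value at [i], so [k] differs from [i] exactly
    when it differs from [k.-1]. The reference point [i] thus disappears from the test, and the
    admissible range starts at [i] itself instead of after it. *)
Lemma first_differsP tr g i k :
  (i < k /\ differs tr g i k /\ (forall m, i < m -> m < k -> ~ differs tr g i m)) <->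
  (i < k /\ changes tr g k.-1 /\ (forall m, i <= m -> m < k.-1 -> ~ changes tr g m)).
Proof.
split=> -[ik [Hk min_k]]; split=> //.
- have same m d : i <= m -> m < k -> List.In d g -> tsem tr V0 d i <-> tsem tr V0 d m.
    rewrite leq_eqVlt => /predU1P[<- //|im] mk dg.
    by apply: NNPP => H; apply: (min_k m) => //; exists d.
  split.
    case: Hk => d dg H; exists d => // E; apply: H.
    rewrite (same k.-1) //; [|lia|lia].
    by rewrite E; have -> : k.-1.+1 = k by lia.
  move=> m im mk [d dg]; apply; rewrite -(same m d) -?(same m.+1 d) //; lia.
- split.
    case: Hk => d dg; have -> : k.-1.+1 = k by lia.
    move=> H; exists d => // E; apply: H.
    by rewrite -E; symmetry; apply: (no_change_const (g := g)) => //; lia.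
  move=> m im mk [d dg]; apply; apply: (no_change_const (g := g)) => //; first lia.
  by move=> l il lm; apply: min_k => //; lia.
Qed.

Lemma never_differsP tr g i :
  (forall m, i < m -> ~ differs tr g i m) <-> (forall m, i <= m -> ~ changes tr g m).
Proof.
split=> H m im; last first.
  case=> d dg; apply; apply: (no_change_const (g := g)) => //; first lia.
  by move=> l il _; apply: H.
have same n d : i <= n -> List.In d g -> tsem tr V0 d i <-> tsem tr V0 d n.
  rewrite leq_eqVlt => /predU1P[<- //|lt_in] dg.
  by apply: NNPP => H'; apply: (H n) => //; exists d.
by case=> d dg; apply; rewrite -(same m d) -?(same m.+1 d) //; lia.
Qed.

Lemma succ_gam_del tr g i k : succ_gam tr g i k ->
  0 < k /\ succ_del (dbl_trace tr) (stutter_t g) i.*2 k.*2.-1.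
Proof.
case=> [/first_differsP[ik [Hk min_k]]|[/never_differsP H ->]].
- split; first lia; left; split; first lia; split.
    apply/stutter_oddP; split; first lia.
    by have -> : k.*2.-1./2 = k.-1 by lia.
  by move=> m im mk /stutter_oddP[om]; apply: min_k; lia.
- split=> //; right; split=> // m im /stutter_oddP[om]; apply: H; lia.
Qed.

(** The default case fits the same formula: from the marker [i.*2] the default successor is the copy
    of [i], again odd, and [p./2.+1] is then [i.+1], the default stuttering successor. *)
Lemma succ_del_gam tr g i p : succ_del (dbl_trace tr) (stutter_t g) i.*2 p ->
  odd p /\ succ_gam tr g i p./2.+1.
Proof.
case=> [[ip [/stutter_oddP[op Hp] min_p]]|[H ->]].
- split=> //; left; apply/first_differsP; split; first lia; split=> // m im mp Hm.
  apply: (min_p m.*2.+1); [lia|move: mp => /=; lia|].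
  by apply/tsem_stutter_odd.
- split; first by rewrite /= odd_double.
  right; split; last by rewrite /= uphalf_double.
  by apply/never_differsP => m im Hm; apply: (H m.*2.+1); [lia|apply/tsem_stutter_odd].
Qed.

Lemma succ_del_marker tr p q : odd p -> succ_del (dbl_trace tr) (tap 0) p q <-> q = p.+1.
Proof.
move=> op; have evp : tsem (dbl_trace tr) V0 (tap 0) p.+1 by rewrite /= op.
split=> [[[pq [_ min_q]]|[H _]]|->].
- have [//|neq] := eqVneq q p.+1; case: (min_q p.+1) => //; lia.
- by case: (H p.+1).
- by left; split=> //; split=> // m; lia.
Qed.

(** * Multitrace formulae *)

Definition dbl_vec n (v : mvec n) : mvec n := fun j => (v j).*2.

Definition half_vec n (v : mvec n) : mvec n := fun j => (v j)./2.

Lemma dbl_vecK n (v : mvec n) : half_vec (dbl_vec v) = v.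
Proof. by apply: functional_extensionality => j; rewrite /half_vec /dbl_vec doubleK. Qed.

Lemma half_vecK n (v : mvec n) : (forall j, ~~ odd (v j)) -> dbl_vec (half_vec v) = v.
Proof.
by move=> ev; apply: functional_extensionality => j; rewrite /half_vec /dbl_vec even_halfK.
Qed.

(** As for trace formulae, the valuations agree only where evaluation takes place, here on vectors
    all of whose components are markers. *)
Lemma msem_dbl n (P : 'I_n -> trace) psi : forall bnd W W', swf n bnd psi ->
  (forall X v, W' X (dbl_vec v) <-> W X v) ->
  forall v, msem (fun j => dbl_trace (P j)) W' (dbl_m psi) (dbl_vec v) <-> ssem P W psi v.
Proof.
elim: psi => [j d|X|a IHa b IHb|a IH|G a IH|X a IH] bnd W W' /= wf WW' v.
- split=> -[j' [jj' H]]; exists j'; split=> //.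
    by case: H => _ [->]; rewrite /dbl_vec tsem_dbl0.
  by exists (v j').*2.+1; split=> //; rewrite tsem_dbl0.
- exact: WW'.
- by case/andP: wf => wa wb; rewrite (IHa _ _ _ wa WW') (IHb _ _ _ wb WW').
- by rewrite (IH _ _ _ wf WW').
- case/andP: wf => /andP[/eqP sG _] wa.
  have nthD (j : 'I_n) :
      nth tdefault (map stutter_t G) j = stutter_t (nth [::] G j).
    by rewrite (nth_map [::]) ?sG.
  have nthm j : nth tdefault (nseq (size G) (tap 0)) j = tap 0.
    by rewrite nth_nseq; case: ifP.
  split=> [[u [vu [w [uw H]]]]|[w [vw H]]].
    have ou j : odd (u j) /\ succ_gam (P j) (nth [::] G j) (v j) (u j)./2.+1.
      by apply: succ_del_gam; rewrite -nthD; apply: vu.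
    have Ew : w = dbl_vec (fun j => (u j)./2.+1).
      apply: functional_extensionality => j; have [oj _] := ou j.
      have := uw j; rewrite nthm succ_del_marker // => ->; rewrite /dbl_vec; lia.
    exists (fun j => (u j)./2.+1); split; first by move=> j; case: (ou j).
    by rewrite -(IH _ _ _ wa WW') -Ew.
  (* The intermediate stop is the copy just before the marker of [w j]. *)
  exists (fun j => (w j).*2.-1); split.
    by move=> j; rewrite nthD; case: (succ_gam_del (vw j)).
  exists (dbl_vec w); split; last by rewrite (IH _ _ _ wa WW').
  move=> j; case: (succ_gam_del (vw j)) => w0 _; rewrite nthm succ_del_marker; last lia.
  rewrite /dbl_vec; lia.
- case/andP: wf => _ wa; split=> [H I clI|H I clI].
    rewrite -(dbl_vecK v).
    (* Every vector with an odd component belongs to this set, so closure matters only on vectors of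
       markers, where [half_vec] inverts [dbl_vec]. *)
    have := H (fun u => (forall j, ~~ odd (u j)) -> I (half_vec u)); apply; last first.
      by move=> j; rewrite odd_double.
    move=> u Hu eu; apply: clI.
    rewrite -(IH _ _ (upd W' X (fun u => (forall j, ~~ odd (u j)) -> I (half_vec u))) wa).
      by rewrite half_vecK.
    move=> Y w; rewrite /upd; case: eqP => _ //; rewrite dbl_vecK.
    by split=> [|//]; apply=> j; rewrite odd_double.
  apply: (H (fun u => I (dbl_vec u))) => u Hu; apply: clI.
  apply/(IH _ (upd W X (fun u => I (dbl_vec u))) _ wa) => //.
  by move=> Y w; rewrite /upd; case: eqP.
Qed.

(** * Traces of the doubled system *)

Lemma nth_dbl_plab (ls : seq (seq nat)) s : s < size ls ->
  let ls' := flatten [seq [:: [:: 0]; [seq a.*2.+1 | a <- l]] | l <- ls] in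
  nth [::] ls' s.*2 = [:: 0] /\
  nth [::] ls' s.*2.+1 = [seq a.*2.+1 | a <- nth [::] ls s].
Proof. by elim: ls s => [|l ls IH] [|s] //= /IH. Qed.

Lemma mem_dbl_odd (s : seq nat) a :
  (a \in [seq b.*2.+1 | b <- s]) = odd a && (a./2 \in s).
Proof.
apply/mapP/andP => [[b bs ->]|[oa As]].
  by rewrite /= odd_double /= uphalf_double.
by exists a./2 => //; lia.
Qed.

Definition dbl_config (c : nat -> config) (i : nat) : config :=
  ((if odd i then (c i./2).1.*2.+1 else (c i./2).1.*2), (c i./2).2).

Lemma step_src_edge P c m c' : pstep P c m c' ->
  src_edge c.1 \in pint (dbl_pds P).
Proof.
rewrite /= !mem_cat; case: m => /=.
- case=> cc' _; apply/orP; left; apply/flattenP.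
  exists [:: src_edge c.1; (c.1.*2.+1, c'.1.*2)]; last exact: mem_head.
  by apply/mapP; exists (c.1, c'.1).
- case=> th [cc' _]; apply/orP; right; apply/orP; left.
  by apply/mapP; exists (c.1, c'.1, th).
- case=> th [cc' _]; apply/orP; right; apply/orP; right.
  by apply/mapP; exists (c.1, th, c'.1).
Qed.

Lemma mem_dbl_pint P s s' : (s, s') \in pint (dbl_pds P) ->
  (~~ odd s /\ s' = s.+1) \/ (odd s /\ ~~ odd s' /\ (s./2, s'./2) \in pint P).
Proof.
have srcE r : (s, s') = src_edge r -> ~~ odd s /\ s' = s.+1.
  by case=> -> ->; rewrite odd_double.
rewrite /= !mem_cat => /or3P[/flattenP[_ /mapP[r rP ->]]|/mapP[r _ /srcE]|/mapP[r _ /srcE]].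
- rewrite !inE => /orP[/eqP/srcE|/eqP[-> ->]]; first by left.
  by right; rewrite /= !odd_double /= uphalf_double doubleK; case: r rP.
- by left.
- by left.
Qed.

Lemma fair_trace_dbl P tr : wf_pds P -> fair_trace P tr ->
  fair_trace (dbl_pds P) (dbl_trace tr).
Proof.
move=> wfP [c [c0 [c0s [cstep [cfair clab]]]]].
(* A state outside the label list would get the default empty label, while its marker must carry
   [0]; well-formedness keeps the run inside the list. *)
have clt i : (c i).1 < size (plab P).
  move: wfP => /andP[/andP[/andP[/andP[/andP[/allP i0 /allP wi] /allP wc] /allP wr] /eqP ->] _].
  case: i => [|i]; first exact: i0.
  have := cstep i; case: (tmv tr i) => /=.
  - by case=> /wi /andP[].
  - by case=> th [/wc /andP[/andP[]]].
  - by case=> th [/wr /andP[]].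
exists (dbl_config c); split; first exact: map_f.
split=> //; split.
  move=> i; rewrite /dbl_config /=; have [oi|ei] := boolP (odd i) => /=; last first.
    have -> : uphalf i = i./2 by lia.
    by split=> //; apply: (step_src_edge (cstep i./2)).
  have -> : uphalf i = i./2.+1 by lia.
  have := cstep i./2; case: (tmv tr i./2) => /=.
  - case=> cc' ->; split=> //; rewrite mem_cat; apply/orP; left; apply/flattenP.
    exists [:: src_edge (c i./2).1; ((c i./2).1.*2.+1, (c i./2.+1).1.*2)].
      by apply/mapP; exists ((c i./2).1, (c i./2.+1).1).
    by rewrite inE mem_head orbT.
  - by case=> th [cc' ->]; exists th; split=> //; apply/mapP; eexists; [exact: cc'|].
  - by case=> th [cc' ->]; exists th; split=> //; apply/mapP; eexists; [exact: cc'|].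
split.
  move=> k; have [i ki Fi] := cfair k; exists i.*2.+1; first lia.
  by rewrite /dbl_config /= odd_double /= uphalf_double map_f.
move=> i a; rewrite /dbl_config /=.
have [le lo] := nth_dbl_plab (clt i./2).
case: ifP => _; last by rewrite le inE.
by rewrite lo mem_dbl_odd clab.
Qed.

(** A parity argument: an even state can only move to its own copy, an odd state only to an even
    one, and runs start in even states. So the state is even exactly at even times, and sampling
    there gives the run of [P]. *)
Lemma fair_trace_half P tr' : wf_pds P -> fair_trace (dbl_pds P) tr' ->
  exists2 tr, fair_trace P tr & tr' = dbl_trace tr.
Proof.
move=> wfP [c [c0 [c0s [cstep [cfair clab]]]]].
have estep i : ~~ odd (c i).1 ->
    [/\ tmv tr' i = Mint, (c i.+1).1 = (c i).1.+1 & (c i.+1).2 = (c i).2].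
  move=> ei; have := cstep i; case: (tmv tr' i) => /=.
  - case=> /(@mem_dbl_pint P)[[_ ->] //|[oi _]]; by rewrite oi in ei.
  - by case=> th [/mapP[r _ [E]]]; rewrite E /= odd_double in ei.
  - by case=> th [/mapP[r _ [E]]]; rewrite E /= odd_double in ei.
have ostep i : odd (c i).1 -> ~~ odd (c i.+1).1 /\
    pstep P ((c i).1./2, (c i).2) (tmv tr' i) ((c i.+1).1./2, (c i.+1).2).
  move=> oi; have := cstep i; case: (tmv tr' i) => /=.
  - by case=> /(@mem_dbl_pint P)[[ei _]|[_ [-> cc']]] ->; first rewrite oi in ei.
  - case=> th [/mapP[r rP [-> -> ->] ->]].
    rewrite odd_double /= uphalf_double doubleK; split=> //; exists r.2; split=> //.
    by move: rP; rewrite -!surjective_pairing.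
  - case=> th [/mapP[r rP [-> -> ->] ->]].
    rewrite odd_double /= uphalf_double doubleK; split=> //; exists r.1.2; split=> //.
    by move: rP; rewrite -!surjective_pairing.
have even_c i : ~~ odd (c i.*2).1.
  elim: i => [|i IH]; first by case/mapP: c0 => s _ ->; rewrite odd_double.
  have [_ E _] := estep _ IH.
  by have [] := ostep i.*2.+1; rewrite ?E /= ?IH // doubleS.
have c1 i : (c i.*2.+1).1 = (c i.*2).1.+1 by case: (estep _ (even_c i)).
pose d i : config := ((c i.*2).1./2, (c i.*2).2).
have dstep i : pstep P (d i) (tmv tr' i.*2.+1) (d i.+1).
  have [_ E1 E2] := estep _ (even_c i).
  have o1 : odd (c i.*2.+1).1 by rewrite c1 /= even_c.
  have [_] := ostep _ o1; rewrite c1 E2 /d doubleS.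
  by have -> : (c i.*2).1.+1./2 = (c i.*2).1./2 by have := even_c i; lia.
have dlt i : (d i).1 < size (plab P).
  move: wfP => /andP[/andP[/andP[/andP[/andP[/allP i0 /allP wi] /allP wc] /allP wr] /eqP ->] _].
  case: i => [|i]; first by apply: i0; case/mapP: c0 => s sP E; rewrite /d E doubleK.
  have := dstep i; case: (tmv tr' i.*2.+1) => /=.
  - by case=> /wi /andP[].
  - by case=> th [/wc /andP[/andP[]]].
  - by case=> th [/wr /andP[]].
pose tr := Trace (fun i a => tlab tr' i.*2.+1 a.*2.+1) (fun i => tmv tr' i.*2.+1).
have labE i a : tlab tr' i.*2.+1 a = odd a && (a./2 \in nth [::] (plab P) (d i).1).
  rewrite clab c1; have [_] := nth_dbl_plab (dlt i).
  have -> : (d i).1.*2 = (c i.*2).1 by rewrite even_halfK.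
  by rewrite /= => ->; rewrite mem_dbl_odd.
exists tr.
  exists d; split; first by case/mapP: c0 => s sP E; rewrite /d E doubleK.
  split=> //; split=> //; split.
    (* All fair states of the doubled system are odd, so the visit found after time [k.*2] happens
       at a copy. *)
    move=> k; have [i ki Fi] := cfair k.*2; move: Fi; rewrite mem_dbl_odd => /andP[oi Fi].
    have oi' : odd i.
      by apply: contraLR oi => ei; have := even_c i./2; rewrite even_halfK.
    exists i./2; first lia.
    move: Fi; have {1}-> : i = i./2.*2.+1 by lia.
    rewrite c1; have -> // : (c i./2.*2).1.+1./2 = (c i./2.*2).1./2.
    by have := even_c i./2; lia.
  by move=> i a; rewrite /= labE /= odd_double /= uphalf_double.
have -> : tr' = Trace (tlab tr') (tmv tr') by case: (tr').
rewrite /dbl_trace; congr Trace; apply: functional_extensionality => i /=.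
- apply: functional_extensionality => a; case: ifP => oi; last first.
    have Ei : i = i./2.*2 by lia.
    rewrite clab Ei; have [+ _] := nth_dbl_plab (dlt i./2).
    have -> : (d i./2).1.*2 = (c i./2.*2).1 by exact: even_halfK (even_c _).
    by rewrite /= => ->; rewrite inE.
  have Ei : i./2.*2.+1 = i by lia.
  rewrite Ei; case oa: (odd a) => /=; last by rewrite -{1}Ei labE oa.
  by have -> : a./2.*2.+1 = a by lia.
- case: ifP => oi; first by have -> : i./2.*2.+1 = i by lia.
  by have [] := estep _ (even_c i./2); rewrite even_halfK ?oi.
Qed.

(** The first two hypotheses make [T'] the image of [T] under doubling, so quantifiers can be
    matched one by one. Agreement is asked below [k] only: the indices not yet quantified hold
    [trace0] on both sides, which is not its own doubling. *)
Lemma satq_dbl T T' (final final' : (nat -> trace) -> Prop) qs :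
  (forall tr, T tr -> T' (dbl_trace tr)) ->
  (forall tr', T' tr' -> exists2 tr, T tr & tr' = dbl_trace tr) ->
  forall k P P',
  (forall j, j < k -> P' j = dbl_trace (P j)) ->
  (forall Q Q', (forall j, j < k + size qs -> Q' j = dbl_trace (Q j)) ->
     (final' Q' <-> final Q)) ->
  satq T' qs k P' final' <-> satq T qs k P final.
Proof.
move=> T1 T2; elim: qs => [|b qs IH] k P P' PP' fin /=.
  by apply: fin => j; rewrite addn0; apply: PP'.
have {}IH tr : satq T' qs k.+1 (upd P' k (dbl_trace tr)) final' <->
    satq T qs k.+1 (upd P k tr) final.
  apply: IH => [j|Q Q' QQ']; last by apply: fin => j; rewrite addnS; apply: QQ'.
  rewrite ltnS leq_eqVlt /upd; case: eqP => //= _; exact: PP'.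
case: b {fin}; split=> H.
- case: H => tr' [/T2[tr Ttr ->]]; rewrite IH; by exists tr.
- case: H => tr [Ttr H]; exists (dbl_trace tr); rewrite IH; by split=> //; apply: T1.
- by move=> tr Ttr; rewrite -IH; apply: H; apply: T1.
- by move=> tr' /T2[tr Ttr ->]; rewrite IH; apply: H.
Qed.

Lemma dbl_inst_holds x : sinst_valid x -> sinst_holds x <-> minst_holds (dbl_inst x).
Proof.
case: x => -[qs psi] P /andP[/= wfpsi wfP]; symmetry; apply: satq_dbl => //.
- by move=> tr; apply: fair_trace_dbl.
- by move=> tr'; apply: fair_trace_half.
move=> Q Q' QQ'; have -> : (fun j : 'I_(size qs) => Q' j) = fun j => dbl_trace (Q j).
  by apply: functional_extensionality => j; apply: QQ'; rewrite add0n.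
(* The initial vector is its own doubling, because [0.*2] computes to [0]. *)
have := @msem_dbl _ (fun j : 'I_(size qs) => Q j) psi [::] (fun _ _ => False)
  (fun _ _ => False) wfpsi (fun _ _ => iff_refl _) (fun=> 0).
exact.
Qed.

(** * Well-formedness of the image *)

Lemma t_pol_dbl d p Y : t_pol p Y (dbl_t d) = t_pol p Y d.
Proof.
by elim: d p => [a|Z|d1 IH1 d2 IH2|d IH|[] d IH|Z d IH] p //=; rewrite ?IH1 ?IH2 ?IH.
Qed.

Lemma twf_dbl d bnd : twf bnd (dbl_t d) = twf bnd d.
Proof.
elim: d bnd => [a|Z|d1 IH1 d2 IH2|d IH|[] d IH|Z d IH] bnd //=;
  by rewrite ?IH1 ?IH2 ?IH ?t_pol_dbl.
Qed.

Lemma twf_stutter bnd g : all (twf bnd) g -> twf bnd (stutter_t g).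
Proof. by rewrite /=; elim: g => //= d g IH /andP[wd /IH ->]; rewrite twf_dbl wd. Qed.

Lemma m_pol_dbl psi p X : m_pol p X (dbl_m psi) = s_pol p X psi.
Proof.
by elim: psi p => [j d|Z|a IHa b IHb|a IH|G a IH|Z a IH] p //=; rewrite ?IHa ?IHb ?IH.
Qed.

Lemma mwf_dbl psi n bnd : swf n bnd psi -> mwf n bnd (dbl_m psi).
Proof.
elim: psi bnd => [j d|X|a IHa b IHb|a IH|G a IH|X a IH] bnd //=.
- by rewrite twf_dbl.
- by case/andP => /IHa -> /IHb.
- exact: IH.
- case/andP => /andP[/eqP sG wG] /IH ->; rewrite size_map size_nseq sG !eqxx !andbT /=.
  apply/andP; split; last by rewrite all_nseq orbT.
  by rewrite all_map; apply: sub_all wG => g; apply: twf_stutter.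
- by rewrite m_pol_dbl => /andP[-> wa]; apply: IH.
Qed.

Lemma wf_dbl_pds P : wf_pds P -> wf_pds (dbl_pds P).
Proof.
move=> /andP[/andP[/andP[/andP[/andP[/allP i0 /allP wi] /allP wc] /allP wr] /eqP sl] /allP wF].
have dl s : s < nst P -> s.*2 < (nst P).*2 by lia.
have dl1 s : s < nst P -> s.*2.+1 < (nst P).*2 by lia.
have srcl s : s < nst P -> ((src_edge s).1 < (nst P).*2) && ((src_edge s).2 < (nst P).*2).
  by move=> ls; rewrite /= dl ?dl1.
rewrite /wf_pds /= !all_cat -!andbA; apply/and5P; split.
- by apply/allP => _ /mapP[s /i0 ls ->]; apply: dl.
- apply/allP => x /flattenP[_ /mapP[r /wi /andP[l1 l2] ->]].
  by rewrite !inE => /orP[] /eqP ->; rewrite /= ?dl ?dl1.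
- by apply/allP => _ /mapP[r /wc /andP[/andP[l1 _] _] ->]; apply: srcl.
- by apply/allP => _ /mapP[r /wr /andP[/andP[l1 _] _] ->]; apply: srcl.
- apply/and4P; split.
  + by apply/allP => _ /mapP[r /wc /andP[/andP[l1 l2] l3] ->] /=; rewrite dl1 ?dl.
  + by apply/allP => _ /mapP[r /wr /andP[/andP[l1 l2] l3] ->] /=; rewrite dl1 ?dl ?l2.
  + by rewrite -sl; elim: (plab P) => //= l ls; rewrite !eqSS.
  + by apply/allP => _ /mapP[s /wF ls ->]; apply: dl1.
Qed.

Lemma dbl_inst_valid x : sinst_valid x -> minst_valid (dbl_inst x).
Proof.
by case/andP => wpsi wP; rewrite /minst_valid /= wf_dbl_pds // andbT; apply: mwf_dbl.
Qed.

Lemma is_kripke_dbl P : is_kripke P -> is_kripke (dbl_pds P).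
Proof. by case/andP => /eqP cP /eqP rP; rewrite /is_kripke /= cP rP. Qed.

(** * While programs over tapes *)

(* [Wr t v d] writes on tape [t] the constant [x] if [v = inl x], or the symbol
   under the head of tape [s] if [v = inr s], and moves the head of [t] by [d]. *)
Inductive cmd :=
  | Skip
  | Wr of nat & nat + nat & dir
  | Seq of cmd & cmd
  | If of nat & seq nat & cmd & cmd
  | While of nat & seq nat & cmd.

Lemma cmd_eq_dec : comparable cmd.
Proof. by rewrite /comparable /decidable; do !decide equality. Qed.

HB.instance Definition _ := hasDecEq.Build cmd (compareP cmd_eq_dec).

(** Sequencing and tests take machine steps of their own, which rewrite the symbols just read and
    leave all heads in place. *)
Fixpoint cmd_step (c : cmd) (rs : seq nat) : option (cmd * seq nat * seq dir) :=
  let stay := nseq (size rs) DS in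
  match c with
  | Skip => None
  | Wr t v d =>
      Some (Skip, set_nth 0 rs t (match v with inl x => x | inr s => nth 0 rs s end),
            set_nth DS stay t d)
  | Seq a b =>
      match cmd_step a rs with
      | Some (a', ws, ds) => Some (Seq a' b, ws, ds)
      | None => Some (b, rs, stay)
      end
  | If t p a b => Some (if nth 0 rs t \in p then a else b, rs, stay)
  | While t p a => Some (if nth 0 rs t \in p then Seq a c else Skip, rs, stay)
  end.

(** The analogue of the partial derivatives of a regular expression: a finite list closed under
    [cmd_step], since a loop unfolds only to a residual of its body followed by the loop itself. The
    program comes first, so it gets the initial state [0]. *)
Fixpoint residuals (c : cmd) : seq cmd :=
  match c with
  | Skip => [:: Skip]
  | Wr _ _ _ => [:: c; Skip]
  | Seq a b => [seq Seq a' b | a' <- residuals a] ++ residuals b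
  | If _ _ a b => c :: residuals a ++ residuals b
  | While _ _ a => c :: Skip :: [seq Seq a' c | a' <- residuals a]
  end.

Fixpoint wf_cmd (k : nat) (c : cmd) : bool :=
  match c with
  | Skip => true
  | Wr t v _ => (t < k) && match v with inl x => x < enc_alphabet | inr s => s < k end
  | Seq a b => wf_cmd k a && wf_cmd k b
  | If _ _ a b => wf_cmd k a && wf_cmd k b
  | While _ _ a => wf_cmd k a
  end.

Definition tm_of (k : nat) (prog : cmd) : TM :=
  Tm k (size (residuals prog)) enc_alphabet
    (fun q rs =>
       match cmd_step (nth Skip (residuals prog) q) rs with
       | Some (c, ws, ds) => Some (index c (residuals prog), ws, ds)
       | None => None
       end).

Lemma residuals_head c : exists r, residuals c = c :: r.
Proof.
elim: c => [|t v d|a [ra Ea] b _|t p a _ b _|t p a _] /=; try by eexists.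
by rewrite Ea /=; eexists.
Qed.

Lemma mem_residuals c : c \in residuals c.
Proof. by case: (residuals_head c) => r ->; rewrite mem_head. Qed.

Lemma residuals_step c0 c rs c' ws ds : c \in residuals c0 ->
  cmd_step c rs = Some (c', ws, ds) -> c' \in residuals c0.
Proof.
elim: c0 c c' ws ds => [|t v d|a IHa b IHb|t p a IHa b IHb|t p a IHa] c c' ws ds /=.
- by rewrite inE => /eqP ->.
- by rewrite !inE => /orP[] /eqP -> //= [<- _ _]; rewrite eqxx orbT.
- rewrite !mem_cat => /orP[/mapP[a' aa' ->] /=|cb /IHb ->]; rewrite ?orbT //.
  case E: (cmd_step a' rs) => [[[a'' ws'] ds']|] [<- _ _].
    by rewrite map_f //; apply: IHa E.
  by rewrite mem_residuals orbT.
- rewrite !inE !mem_cat => /or3P[/eqP -> [<- _ _]|/IHa{}IHa /IHa ->|/IHb{}IHb /IHb ->];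
    rewrite ?orbT //.
  by case: ifP; rewrite mem_residuals ?orbT.
- rewrite !inE => /or3P[/eqP -> [<- _ _]|/eqP -> //|/mapP[a' aa' -> /=]].
    case: ifP => _; last by rewrite eqxx orbT.
    by rewrite map_f ?orbT // mem_residuals.
  case E: (cmd_step a' rs) => [[[a'' ws'] ds']|] [<- _ _]; last by rewrite eqxx.
  by rewrite map_f ?orbT //; apply: IHa E.
Qed.

Lemma wf_residuals k c0 c : wf_cmd k c0 -> c \in residuals c0 -> wf_cmd k c.
Proof.
elim: c0 c => [|t v d|a IHa b IHb|t p a IHa b IHb|t p a IHa] c /=.
- by rewrite inE => _ /eqP ->.
- by rewrite !inE => wv /orP[] /eqP ->.
- case/andP => wa wb; rewrite mem_cat => /orP[/mapP[a' aa' ->] /=|/IHb->] //.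
  by rewrite wb IHa.
- case/andP => wa wb; rewrite inE mem_cat => /or3P[/eqP ->|/IHa ->|/IHb ->] //=.
  by rewrite wa.
- move=> wa; rewrite !inE => /or3P[/eqP ->|/eqP ->|/mapP[a' aa' ->]] //=.
  by rewrite wa IHa.
Qed.

Lemma cmd_step_wf k c rs c' ws ds : wf_cmd k c -> size rs = k ->
  all (fun a => a < enc_alphabet) rs -> cmd_step c rs = Some (c', ws, ds) ->
  [/\ size ws = k, size ds = k & all (fun a => a < enc_alphabet) ws].
Proof.
move=> + szk /allP small; elim: c c' ws ds => [|t v d|a IHa b IHb|t p a _ b _|t p a _] c' ws ds //=.
- case/andP => tk wv [_ <- <-]; rewrite !size_set_nth size_nseq szk.
  have mk : maxn t.+1 k = k by lia.
  split=> //; apply/(all_nthP 0) => i; rewrite size_set_nth szk mk => ik.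
  rewrite nth_set_nth /=; case: eqP => _; last by apply: small; rewrite mem_nth ?szk.
  by case: v wv => // s sk; apply: small; rewrite mem_nth ?szk.
- case/andP => wa wb; case: (cmd_step a rs) IHa => [[[a' ws'] ds']|] IHa.
    by case=> _ <- <-; apply: IHa.
  by case=> _ <- <-; rewrite size_nseq; split=> //; apply/allP.
- by move=> _ [_ <- <-]; rewrite size_nseq; split=> //; apply/allP.
- by move=> _ [_ <- <-]; rewrite size_nseq; split=> //; apply/allP.
Qed.

Lemma wf_tm_of k prog : 0 < k -> wf_cmd k prog -> wf_TM (tm_of k prog).
Proof.
move=> k0 wp; split=> //; split; first by case: (residuals_head prog) => r /= ->.
split=> // q rs q' ws ds /= qs szr small.
have qr := mem_nth Skip qs.
case E: cmd_step => [[[c' ws'] ds']|] // [<- <- <-].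
have [-> -> ->] := cmd_step_wf (wf_residuals wp qr) szr small E.
by split=> //; rewrite index_mem (residuals_step qr E).
Qed.

(** * Tapes up to trailing blanks *)

(** Stores no blank at the far end of a half tape. The machine itself remembers every blank cell it
    has visited, so without this normal form a tape that was scanned and restored would differ from
    the original. *)
Definition bcons (x : nat) (l : seq nat) : seq nat :=
  if (x == 0) && nilp l then [::] else x :: l.

Definition amove (t : tape) (d : dir) : tape :=
  let: (l, h, r) := t in
  match d with
  | DL => (behead l, head 0 l, bcons h r)
  | DR => (bcons h l, head 0 r, behead r)
  | DS => t
  end.

Definition trimmed (t a : tape) : Prop :=
  exists j k, t = (a.1.1 ++ nseq j 0, a.1.2, a.2 ++ nseq k 0).

Definition awrite (m : seq tape) (t x : nat) (d : dir) : seq tape :=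
  set_nth blank_tape m t (amove (write_tape (nth blank_tape m t) x) d).

Fixpoint astep (c : cmd) (m : seq tape) : option (cmd * seq tape) :=
  let hd t := (nth blank_tape m t).1.2 in
  match c with
  | Skip => None
  | Wr t v d => Some (Skip, awrite m t (match v with inl x => x | inr s => hd s end) d)
  | Seq a b =>
      match astep a m with
      | Some (a', m') => Some (Seq a' b, m')
      | None => Some (b, m)
      end
  | If t p a b => Some (if hd t \in p then a else b, m)
  | While t p a => Some (if hd t \in p then Seq a c else Skip, m)
  end.

Fixpoint arun (n : nat) (cm : cmd * seq tape) : option (cmd * seq tape) :=
  if n is n'.+1 then
    if astep cm.1 cm.2 is Some cm' then arun n' cm' else None
  else Some cm.

Definition heads (ts : seq tape) : seq nat := [seq t.1.2 | t <- ts].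

Definition tapes_step (ts : seq tape) (ws : seq nat) (ds : seq dir) : seq tape :=
  [seq move_tape (write_tape p.1 p.2.1) p.2.2 | p <- zip ts (zip ws ds)].

Definition trimmeds (ts m : seq tape) : Prop :=
  size ts = size m /\ forall i, trimmed (nth blank_tape ts i) (nth blank_tape m i).

Lemma cat_bcons x l k : exists k', x :: l ++ nseq k 0 = bcons x l ++ nseq k' 0.
Proof.
rewrite /bcons; case: x l => [|x] [|y l]; try by exists k.
by exists k.+1.
Qed.

Lemma head_cat_blank l k : exists k',
  head 0 (l ++ nseq k 0) = head 0 l /\ behead (l ++ nseq k 0) = behead l ++ nseq k' 0.
Proof.
case: l => [|x l]; last by exists k.
by exists k.-1; case: k.
Qed.

Lemma trimmed_step t a x d : trimmed t a ->
  trimmed (move_tape (write_tape t x) d) (amove (write_tape a x) d).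
Proof.
case: a => [[l h] r] [j [k ->]] /=; case: d => /=.
- have [k' Ek] := cat_bcons x r k; have [j' [Eh Eb]] := head_cat_blank l j.
  exists j', k'; move: Eh Eb; case: (l ++ nseq j 0) => [|y l'] /= Eh Eb;
    by rewrite Ek /= -?Eb -Eh.
- have [j' Ej] := cat_bcons x l j; have [k' [Eh Eb]] := head_cat_blank r k.
  exists j', k'; move: Eh Eb; case: (r ++ nseq k 0) => [|y l'] /= Eh Eb;
    by rewrite Ej /= -?Eb -Eh.
- by exists j, k.
Qed.

Lemma tapes_step_stay ts : tapes_step ts (heads ts) (nseq (size ts) DS) = ts.
Proof. by elim: ts => //= -[[l h] r] ts IH; rewrite /tapes_step /= -/(tapes_step _ _ _) IH. Qed.

Lemma tapes_step_set ts t x d : t < size ts ->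
  tapes_step ts (set_nth 0 (heads ts) t x) (set_nth DS (nseq (size ts) DS) t d) =
  set_nth blank_tape ts t (move_tape (write_tape (nth blank_tape ts t) x) d).
Proof.
elim: ts t => //= -[[l h] r] ts IH [|t] /= lt.
  by rewrite /tapes_step /= -/(tapes_step _ _ _) tapes_step_stay.
by rewrite /tapes_step /= -/(tapes_step _ _ _) IH.
Qed.

Lemma nth_heads ts m t : trimmeds ts m ->
  nth 0 (heads ts) t = (nth blank_tape m t).1.2.
Proof.
case=> sz /(_ t) [j [k E]]; have [lt|ge] := ltnP t (size ts).
  by rewrite (nth_map blank_tape) // E.
by rewrite nth_default ?size_map // nth_default // -sz.
Qed.

Lemma cmd_step_astep k c ts m : wf_cmd k c -> size ts = k -> trimmeds ts m ->
  match astep c m with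
  | None => cmd_step c (heads ts) = None
  | Some (c', m') => exists ws ds, cmd_step c (heads ts) = Some (c', ws, ds) /\
      trimmeds (tapes_step ts ws ds) m'
  end.
Proof.
move=> + szk tm.
have stay : trimmeds (tapes_step ts (heads ts) (nseq (size (heads ts)) DS)) m.
  by rewrite size_map tapes_step_stay.
have hdE t := nth_heads t tm.
elim: c => [|t v d|a IHa b _|t p a _ b _|t p a _] //=.
- case/andP => tk _; do 2![eexists]; split; first reflexivity.
  rewrite size_map tapes_step_set ?szk // /awrite.
  have -> : match v with inl x => x | inr s => nth 0 (heads ts) s end =
      match v with inl x => x | inr s => (nth blank_tape m s).1.2 end.
    by case: v => // s; rewrite hdE.
  case: tm => sz tm; split; first by rewrite !size_set_nth sz.
  move=> i; rewrite !nth_set_nth /=; case: eqP => _ //.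
  exact: trimmed_step.
- case/andP => wa _; case: (astep a m) IHa => [[a' m']|] IHa.
    by have [ws [ds [-> tm']]] := IHa wa; exists ws, ds.
  by rewrite IHa //; do 2![eexists].
- by rewrite hdE; do 2![eexists].
- by rewrite hdE; do 2![eexists].
Qed.

Lemma tm_run_arun k prog n c ts m c' m' : wf_cmd k prog -> size m = k ->
  c \in residuals prog -> trimmeds ts m -> arun n (c, m) = Some (c', m') ->
  exists2 ts', trimmeds ts' m' /\ c' \in residuals prog &
    tm_run (tm_of k prog) n (index c (residuals prog), ts) =
    Some (index c' (residuals prog), ts').
Proof.
move=> wp; elim: n c ts m => [|n IH] c ts m szm cr tm /=.
  by case=> <- <-; exists ts.
have szt : size ts = k by rewrite -szm; case: tm.
have := cmd_step_astep (wf_residuals wp cr) szt tm.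
case E: (astep c m) => [[c1 m1]|] // [ws [ds [Ec tm1]]] run.
rewrite nth_index // -/(heads ts) Ec; apply: (IH _ _ _ _ _ tm1 run).
- case: tm1 => <- _; rewrite /tapes_step size_map.
  have wc := wf_residuals wp cr.
  have : size ws = size ts /\ size ds = size ts.
    have gen : forall c c1 ws ds, wf_cmd k c -> cmd_step c (heads ts) = Some (c1, ws, ds) ->
        size ws = size ts /\ size ds = size ts.
      elim=> [|t v d|a IHa b _|t p a _ b _|t p a _] c2 ws2 ds2 //=.
      + case/andP=> tk _ [_ <- <-]; rewrite !size_set_nth size_nseq size_map szt.
        by split; lia.
      + case/andP => wa _; case: (cmd_step a _) IHa => [[[? ?] ?]|] IHa [_ <- <-].
          exact: IHa.
        by rewrite size_nseq size_map.
      + by move=> _ [_ <- <-]; rewrite size_nseq size_map.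
      + by move=> _ [_ <- <-]; rewrite size_nseq size_map.
    exact: gen wc Ec.
  by case=> sw sd; rewrite !size_zip sw sd !minnn.
- exact: residuals_step Ec.
Qed.

(** * Reasoning about programs *)

(* The input tape (tape 0) is read once from left to right, so what lies to the
   left of its head is quantified away. *)
Definition leads n c s m c' s' m' := forall l, exists t l', t <= n /\
  arun t (c, (l, head 0 s, behead s) :: m) = Some (c', (l', head 0 s', behead s') :: m').

Notation exec n c s m s' m' := (leads n c s m Skip s' m').

Lemma arun_cat n1 n2 x : arun (n1 + n2) x = obind (arun n2) (arun n1 x).
Proof. by elim: n1 x => //= n1 IH x; case: astep. Qed.

Lemma arun_seq n a b m a' m' : arun n (a, m) = Some (a', m') ->
  arun n (Seq a b, m) = Some (Seq a' b, m').
Proof.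
elim: n a m => [|n IH] a m /=; first by case=> -> ->.
by case: (astep a m) => [[a1 m1]|] //= /IH.
Qed.

Lemma leads_refl c s m : leads 0 c s m c s m.
Proof. by move=> l; exists 0, l. Qed.

Lemma leads_le n n' c s m c' s' m' : leads n c s m c' s' m' -> n <= n' ->
  leads n' c s m c' s' m'.
Proof. by move=> H le l; have [t [l' [tn r]]] := H l; exists t, l'; split=> //; lia. Qed.

Lemma leads_trans n1 n2 c s m c1 s1 m1 c2 s2 m2 :
  leads n1 c s m c1 s1 m1 -> leads n2 c1 s1 m1 c2 s2 m2 ->
  leads (n1 + n2) c s m c2 s2 m2.
Proof.
move=> H1 H2 l; have [t1 [l1 [tn1 r1]]] := H1 l; have [t2 [l2 [tn2 r2]]] := H2 l1.
exists (t1 + t2), l2; split; first lia.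
by rewrite arun_cat r1.
Qed.

(** The additional step is the one from [Seq Skip b] to [b]. A loop iteration costs two: the test
    and this step. *)
Lemma leads_seq n1 n2 a b s m s1 m1 c2 s2 m2 :
  exec n1 a s m s1 m1 -> leads n2 b s1 m1 c2 s2 m2 ->
  leads (n1 + n2).+1 (Seq a b) s m c2 s2 m2.
Proof.
move=> H1 H2; rewrite -addnS; apply: (leads_trans (c1 := Seq Skip b) (s1 := s1) (m1 := m1)).
  move=> l; have [t1 [l1 [tn1 r1]]] := H1 l.
  by exists t1, l1; split=> //; apply: arun_seq.
move=> l; have [t2 [l2 [tn2 r2]]] := H2 l.
by exists t2.+1, l2.
Qed.

(** The input tape is kept apart as its unread suffix [s], so machine tape [t.+1] is entry [t] of
    [m]; all later index shifts stem from this. *)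
Definition hd_at (s : seq nat) (m : seq tape) (t : nat) : nat :=
  if t is t'.+1 then (nth blank_tape m t').1.2 else head 0 s.

Lemma leads_one c s m c' s' m' :
  (forall l, exists l', astep c ((l, head 0 s, behead s) :: m) =
     Some (c', (l', head 0 s', behead s') :: m')) -> leads 1 c s m c' s' m'.
Proof. by move=> H l; have [l' E] := H l; exists 1, l'; rewrite /= E. Qed.

Lemma exec_if n t p a b s m s' m' :
  exec n (if hd_at s m t \in p then a else b) s m s' m' ->
  exec n.+1 (If t p a b) s m s' m'.
Proof.
move=> H; rewrite -add1n; apply: leads_trans H.
by apply: leads_one => l; exists l; case: t.
Qed.

Lemma leads_while n t p a s m s' m' : hd_at s m t \in p ->
  exec n a s m s' m' -> leads n.+2 (While t p a) s m (While t p a) s' m'.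
Proof.
move=> tp H; rewrite -addn2 addnC -[2]/(1 + 1) -addnA.
apply: (leads_trans (c1 := Seq a (While t p a)) (s1 := s) (m1 := m)).
  by apply: leads_one => l; exists l; move: tp; case: t => /= [|t] ->.
by rewrite add1n -[n]addn0; apply: leads_seq H (leads_refl _ _ _).
Qed.

Lemma exec_while0 t p a s m : hd_at s m t \notin p -> exec 1 (While t p a) s m s m.
Proof. by move=> /negPf tp; apply: leads_one => l; exists l; move: tp; case: t => /= [|t] ->. Qed.

Lemma exec_adv x s m : exec 1 (Wr 0 (inr 0) DR) (x :: s) m s m.
Proof. by apply: leads_one => l; exists (bcons x l). Qed.

Lemma exec_wr t v d s m :
  exec 1 (Wr t.+1 v d) s m s (awrite m t (match v with inl x => x | inr u => hd_at s m u end) d).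
Proof. by apply: leads_one => l; exists l; case: v => [x|[|u]]. Qed.

(* A tape holding [w], with the head on the first blank to its right. *)
Definition hld (w : seq nat) : tape := (rev w, 0, [::]).

Definition appt (ms : seq (seq nat)) (t : nat) (u : seq nat) :=
  set_nth [::] ms t (nth [::] ms t ++ u).

Lemma awrite_hld ms t x : x != 0 -> t < size ms ->
  awrite (map hld ms) t x DR = map hld (appt ms t [:: x]).
Proof.
move=> x0 lt; rewrite /awrite (nth_map [::]) //= /bcons (negPf x0) /=.
elim: ms t lt => [|u ms IH] [|t] //= lt; first by rewrite /hld rev_cat.
by rewrite IH.
Qed.

Lemma exec_put t x s ms : x != 0 -> t < size ms ->
  exec 1 (Wr t.+1 (inl x) DR) s (map hld ms) s (map hld (appt ms t [:: x])).
Proof. by move=> x0 lt; rewrite -awrite_hld //; apply: exec_wr. Qed.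

Definition Emit (t : nat) (xs : seq nat) : cmd :=
  foldr (fun x c => Seq (Wr t (inl x) DR) c) Skip xs.

Lemma appt_cat ms t u v : appt (appt ms t u) t v = appt ms t (u ++ v).
Proof. by rewrite /appt nth_set_nth /= eqxx set_set_nth eqxx catA. Qed.

Lemma size_appt ms t u : t < size ms -> size (appt ms t u) = size ms.
Proof. by move=> lt; rewrite size_set_nth; lia. Qed.

Lemma appt0 ms t : t < size ms -> appt ms t [::] = ms.
Proof.
move=> lt; apply: (@eq_from_nth _ [::]) => [|i]; rewrite ?size_appt // => li.
by rewrite /appt nth_set_nth /= cats0; case: eqP => [->|].
Qed.

Lemma exec_emit t xs s ms : all (predC1 0) xs -> t < size ms ->
  exec (2 * size xs) (Emit t.+1 xs) s (map hld ms) s (map hld (appt ms t xs)).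
Proof.
elim: xs ms => [|x xs IH] ms /=.
  by move=> _ lt; rewrite appt0 //; apply: leads_refl.
case/andP => x0 xs0 lt; apply: leads_le.
  apply: leads_seq; first exact: exec_put x0 lt.
  by have := IH (appt ms t [:: x]) xs0; rewrite size_appt // appt_cat; apply.
rewrite /=; lia.
Qed.

Definition Copy (t : nat) : cmd := Seq (Wr t (inr 0) DR) (Wr 0 (inr 0) DR).

Lemma exec_copy t x s ms : x != 0 -> t < size ms ->
  exec 3 (Copy t.+1) (x :: s) (map hld ms) s (map hld (appt ms t [:: x])).
Proof.
move=> x0 lt; have H := exec_wr t (inr 0) DR (x :: s) (map hld ms).
rewrite /= awrite_hld // in H.
exact: leads_seq H (exec_adv _ _ _).
Qed.

Definition nonblank : seq nat := iota 1 24.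

Lemma nonblank_neq0 x : x \in nonblank -> x != 0.
Proof. by case: x. Qed.

Definition Rewind (t : nat) : cmd :=
  Seq (Wr t (inr t) DL) (Seq (While t nonblank (Wr t (inr t) DL)) (Wr t (inr t) DR)).

(* Appends the content of tape [s] to tape [t], after running [pre] with the
   head of [s] on its first symbol. *)
Definition Transfer (s t : nat) (pre : cmd) : cmd :=
  Seq (Rewind s) (Seq pre
    (While s nonblank (Seq (Wr t (inr s) DR) (Wr s (inr s) DR)))).

Definition Clear (t : nat) : cmd :=
  Seq (Wr t (inr t) DL) (While t nonblank (Wr t (inl 0) DL)).

(** All tapes at rest at the end of their words except [s], which is being scanned. *)
Definition setz (ms : seq (seq nat)) (s : nat) (z : tape) : seq tape :=
  set_nth blank_tape (map hld ms) s z.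

Lemma nth_setz ms s z t : nth blank_tape (setz ms s z) t =
  if t == s then z else hld (nth [::] ms t).
Proof.
rewrite nth_set_nth /=; case: eqP => // _.
have [lt|ge] := ltnP t (size ms); first by rewrite (nth_map [::]).
by rewrite !nth_default ?size_map.
Qed.

Lemma awrite_setz ms s z x d :
  awrite (setz ms s z) s x d = setz ms s (amove (write_tape z x) d).
Proof. by rewrite /awrite nth_setz eqxx /setz set_set_nth eqxx. Qed.

Lemma eq_setz ms ms' s z : s < size ms -> size ms = size ms' ->
  (forall i, i != s -> nth [::] ms i = nth [::] ms' i) -> setz ms s z = setz ms' s z.
Proof.
move=> ls sz E; apply: (@eq_from_nth _ blank_tape) => [|i li].
  by rewrite !size_set_nth !size_map sz.
by rewrite !nth_setz; case: eqP => // /eqP /E ->.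
Qed.

Lemma setz_hld ms s : s < size ms -> setz ms s (hld (nth [::] ms s)) = map hld ms.
Proof.
move=> ls; apply: (@eq_from_nth _ blank_tape) => [|i].
  rewrite size_set_nth !size_map; lia.
rewrite size_set_nth size_map => li.
by rewrite nth_setz (nth_map [::]) //; [case: eqP => // -> | lia].
Qed.

Lemma awrite_setz_neq ms s z t x : x != 0 -> t < size ms -> s < size ms -> t != s ->
  awrite (setz ms s z) t x DR = setz (appt ms t [:: x]) s z.
Proof.
move=> x0 lt ls ts; rewrite /awrite nth_setz (negPf ts) /= /bcons (negPf x0) /=.
apply: (@eq_from_nth _ blank_tape) => [|i li].
  by rewrite /setz !size_set_nth !size_map size_appt // ; lia.
rewrite nth_set_nth /= !nth_setz /= /appt nth_set_nth /=; case: (eqVneq i t) => [->|//].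
by rewrite (negPf ts) /hld rev_cat.
Qed.

Lemma exec_wr_setz s ms z t v d :
  exec 1 (Wr t.+1 v d) s (setz ms t z) s
    (setz ms t (amove (write_tape z (match v with inl x => x | inr u => hd_at s (setz ms t z) u end)) d)).
Proof. by rewrite -awrite_setz; apply: exec_wr. Qed.

Lemma exec_mv_setz s ms z t d : exec 1 (Wr t.+1 (inr t.+1) d) s (setz ms t z) s
    (setz ms t (amove z d)).
Proof.
have := exec_wr_setz s ms z t (inr t.+1) d; rewrite /= nth_setz eqxx.
by case: z => [[l h] r].
Qed.

Lemma exec_emit_setz s t xs z inp ms : all (predC1 0) xs -> t < size ms ->
  s < size ms -> t != s ->
  exec (2 * size xs) (Emit t.+1 xs) inp (setz ms s z) inp (setz (appt ms t xs) s z).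
Proof.
move=> + lt ls ts; elim: xs ms lt ls => [|x xs IH] ms lt ls /=.
  by move=> _; rewrite appt0 //; apply: leads_refl.
case/andP => x0 xs0; apply: leads_le.
  apply: leads_seq; first exact: exec_wr.
  by have := IH (appt ms t [:: x]); rewrite awrite_setz_neq // size_appt // appt_cat; apply.
rewrite /=; lia.
Qed.

(** The scan runs onto the blank left of the word and steps back once. Tapes extend to the left, so
    this also works for the empty word, and [bcons] discards the blank that was visited. *)
Lemma exec_rewind s inp ms (w : seq nat) : nth [::] ms s = w -> s < size ms ->
  all (mem nonblank) w ->
  exec (3 * size w + 5) (Rewind s.+1) inp (map hld ms) inp
    (setz ms s ([::], head 0 w, behead w)).
Proof.
move=> Ew ls nbw; rewrite -(setz_hld ls) Ew.
have loop (ru v : seq nat) : all (mem nonblank) ru ->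
    exec (3 * size ru + 1) (While s.+1 nonblank (Wr s.+1 (inr s.+1) DL)) inp
      (setz ms s (behead ru, head 0 ru, v)) inp (setz ms s ([::], 0, catrev ru v)).
  elim: ru v => [|x ru IH] v /=; first by move=> _; apply: exec_while0; rewrite /= nth_setz eqxx.
  case/andP => nx nru; apply: leads_le.
    apply: leads_trans; last exact: (IH (x :: v) nru).
    apply: leads_while; first by rewrite /= nth_setz eqxx.
    have := exec_mv_setz inp ms (ru, x, v) s DL.
    by rewrite /= {1}/bcons (negPf (nonblank_neq0 nx)); apply.
  lia.
apply: leads_le.
  apply: leads_seq; first exact: exec_mv_setz.
  apply: leads_seq; first by apply: loop; rewrite all_rev.
  have := exec_mv_setz inp ms ([::], 0, catrev (rev w) [::]) s DR.
  by rewrite /= -/(rev (rev w)) revK; apply.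
rewrite size_rev; lia.
Qed.

Lemma nth_appt ms t u i :
  nth [::] (appt ms t u) i = if i == t then nth [::] ms t ++ u else nth [::] ms i.
Proof. by rewrite nth_set_nth. Qed.

(** [po] is what [pre] prints after inspecting the first symbol of [w]; it serves to double a number
    held on a tape, where zero must be told apart. Tape [s] ends as it began, ready for the next
    transfer. *)
Lemma exec_transfer n s t pre inp ms (w po : seq nat) : nth [::] ms s = w -> s < size ms -> t < size ms ->
  t != s -> all (mem nonblank) w ->
  (let z := ([::], head 0 w, behead w) in
   exec n pre inp (setz ms s z) inp (setz (appt ms t po) s z)) ->
  exec (n + 8 * size w + 8) (Transfer s.+1 t.+1 pre) inp (map hld ms) inp
    (map hld (appt ms t (po ++ w))).
Proof.
move=> Ew ls lt ts nbw Hpre.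
have loop (u v : seq nat) ms' : size ms' = size ms -> all (mem nonblank) v ->
    exec (5 * size v + 1)
      (While s.+1 nonblank (Seq (Wr t.+1 (inr s.+1) DR) (Wr s.+1 (inr s.+1) DR))) inp
      (setz ms' s (rev u, head 0 v, behead v)) inp (setz (appt ms' t v) s (hld (u ++ v))).
  move=> szm; elim: v u ms' szm => [|x v IH] u ms' szm /=.
    by move=> _; rewrite cats0 appt0 ?szm //; apply: exec_while0; rewrite /= nth_setz eqxx.
  case/andP => nx nv; have x0 := nonblank_neq0 nx; apply: leads_le.
    apply: leads_trans; last first.
      have szm' : size (appt ms' t [:: x]) = size ms by rewrite size_appt szm.
      have := IH (rcons u x) (appt ms' t [:: x]) szm' nv.
      by rewrite appt_cat cat_rcons; apply.
    apply: leads_while; first by rewrite /= nth_setz eqxx.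
    apply: leads_seq.
      have := exec_wr t (inr s.+1) DR inp (setz ms' s (rev u, x, v)).
      by rewrite /= nth_setz eqxx /= awrite_setz_neq ?szm //; apply.
    have := exec_mv_setz inp (appt ms' t [:: x]) (rev u, x, v) s DR.
    by rewrite /= {1}/bcons (negPf x0) rev_rcons; apply.
  lia.
apply: leads_le.
  apply: leads_seq; first exact: exec_rewind Ew ls nbw.
  apply: leads_seq; first exact: Hpre.
  have := loop [::] w (appt ms t po); rewrite size_appt // appt_cat => /(_ erefl nbw).
  have {1}<- : nth [::] (appt ms t (po ++ w)) s = [::] ++ w.
    by rewrite nth_appt eq_sym (negPf ts).
  by rewrite setz_hld ?size_appt //; apply.
lia.
Qed.

Lemma exec_transfer0 s t inp ms (w : seq nat) : nth [::] ms s = w -> s < size ms -> t < size ms ->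
  t != s -> all (mem nonblank) w ->
  exec (8 * size w + 8) (Transfer s.+1 t.+1 Skip) inp (map hld ms) inp (map hld (appt ms t w)).
Proof.
move=> Ew ls lt ts nbw; have := exec_transfer (n := 0) (pre := Skip) (inp := inp) (po := [::]) Ew ls lt ts nbw.
by apply; rewrite appt0 //; apply: leads_refl.
Qed.

Lemma exec_clear s inp ms (w : seq nat) : nth [::] ms s = w -> s < size ms ->
  all (mem nonblank) w ->
  exec (3 * size w + 3) (Clear s.+1) inp (map hld ms) inp (map hld (set_nth [::] ms s [::])).
Proof.
move=> Ew ls nbw; rewrite -{1}(setz_hld ls) Ew.
have loop (ru : seq nat) : all (mem nonblank) ru ->
    exec (3 * size ru + 1) (While s.+1 nonblank (Wr s.+1 (inl 0) DL)) inp
      (setz ms s (behead ru, head 0 ru, [::])) inp (setz ms s (hld [::])).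
  elim: ru => [|x ru IH] /=; first by move=> _; apply: exec_while0; rewrite /= nth_setz eqxx.
  case/andP => nx nru; apply: leads_le.
    apply: leads_trans; last exact: (IH nru).
    apply: leads_while; first by rewrite /= nth_setz eqxx.
    exact: exec_wr_setz.
  lia.
have -> : map hld (set_nth [::] ms s [::]) = setz ms s (hld [::]).
  have ls' : s < size (set_nth [::] ms s [::]) by rewrite size_set_nth; lia.
  rewrite -(setz_hld ls') nth_set_nth /= eqxx; apply: eq_setz => //.
    rewrite size_set_nth; lia.
  by move=> i /negPf si; rewrite nth_set_nth /= si.
apply: leads_le.
  apply: leads_seq; first exact: exec_mv_setz.
  by apply: (loop (rev w)); rewrite all_rev.
rewrite size_rev; lia.
Qed.

Lemma leads_eqm n c s m c' s' m' m2 : leads n c s m c' s' m' -> m' = m2 ->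
  leads n c s m c' s' m2.
Proof. by move=> H <-. Qed.

Lemma exec_if_true n t p a b s m s' m' : hd_at s m t \in p ->
  exec n a s m s' m' -> exec n.+1 (If t p a b) s m s' m'.
Proof. by move=> tp H; apply: exec_if; rewrite tp. Qed.

Lemma exec_if_false n t p a b s m s' m' : hd_at s m t \notin p ->
  exec n b s m s' m' -> exec n.+1 (If t p a b) s m s' m'.
Proof. by move=> /negPf tp H; apply: exec_if; rewrite tp. Qed.

(** The two steps of overhead per iteration are charged to the code of the element, which is
    nonempty; hence the factor [K + 2]. *)
Lemma leads_while_list (A X : Type) (e : A -> seq nat) (mm : X -> seq tape)
    (f : X -> A -> X) K p body xs :
  (forall x, 0 < size (e x) /\ forall s, head 0 (e x ++ s) \in p) ->
  (forall x acc s, exec (K * size (e x)) body (e x ++ s) (mm acc) s (mm (f acc x))) ->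
  forall acc s, leads ((K + 2) * size (flatten (map e xs))) (While 0 p body)
    (flatten (map e xs) ++ s) (mm acc) (While 0 p body) s (mm (foldl f acc xs)).
Proof.
move=> He Hb; elim: xs => [|x xs IH] acc s /=; first by rewrite muln0; apply: leads_refl.
rewrite -catA; have [szx hx] := He x; apply: leads_le.
  apply: leads_trans; last exact: IH.
  apply: leads_while; first exact: hx.
  exact: Hb.
rewrite size_cat mulnDr; nia.
Qed.

Lemma exec_while_list (A X : Type) (e : A -> seq nat) (mm : X -> seq tape)
    (f : X -> A -> X) K p body xs acc s :
  (forall x, 0 < size (e x) /\ forall s, head 0 (e x ++ s) \in p) ->
  (forall x acc s, exec (K * size (e x)) body (e x ++ s) (mm acc) s (mm (f acc x))) ->
  head 0 s \notin p ->
  exec ((K + 2) * size (flatten (map e xs)) + 1) (While 0 p body)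
    (flatten (map e xs) ++ s) (mm acc) s (mm (foldl f acc xs)).
Proof.
move=> He Hb hs; apply: leads_trans; first exact: leads_while_list He Hb _ _.
exact: exec_while0.
Qed.

(** * Encodings *)

Arguments enc_nat : simpl never.
Arguments stutter_t : simpl never.

Lemma bits_fuel_ext f g n : n <= f -> n <= g -> bits_fuel f n = bits_fuel g n.
Proof.
elim: f g n => [|f IH] [|g] [|n] //= nf ng; congr (_ :: _); apply: IH; lia.
Qed.

(** Codes are little-endian, so doubling acts at the front, before the number has been read. Zero
    has no digits and is its own double, hence the exception, which [n.*2.+1] does not need. *)
Lemma enc_nat_double n : 0 < n -> enc_nat n.*2 = 1 :: enc_nat n.
Proof.
case: n => // n _; rewrite /enc_nat.
have -> : bits_fuel n.+1.*2 n.+1.*2 = 1 :: bits_fuel n.*2.+1 n.+1.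
  by rewrite doubleS [LHS]/= odd_double doubleK.
by rewrite (@bits_fuel_ext n.*2.+1 n.+1) //; lia.
Qed.

Lemma enc_nat_odd n : enc_nat n.*2.+1 = 2 :: enc_nat n.
Proof.
rewrite /enc_nat /= odd_double /= uphalf_double; congr (_ :: (_ ++ _)).
by apply: bits_fuel_ext; lia.
Qed.

Lemma bits_fuel_digits f n : all (mem [:: 1; 2]) (bits_fuel f n).
Proof. by elim: f n => //= f IH n; case: ifP => //= _; rewrite IH; case: odd. Qed.

(** Scans find the end of a word by its first blank, so every word put on a tape must satisfy
    this. *)
Definition nb (s : seq nat) : bool := all (mem nonblank) s.

Arguments nb : simpl never.

Lemma nb_cat s1 s2 : nb (s1 ++ s2) = nb s1 && nb s2.
Proof. exact: all_cat. Qed.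

Lemma nb_nil : nb [::].
Proof. by []. Qed.

Lemma nb_cons x s : nb (x :: s) = (0 < x < 25) && nb s.
Proof. by rewrite /nb /= mem_iota. Qed.

Lemma nb_nat n : nb (enc_nat n).
Proof.
rewrite nb_cat andbT; apply: sub_all (bits_fuel_digits n n) => x.
by rewrite !inE => /orP[] /eqP ->.
Qed.

Lemma nb_t d : nb (enc_t d).
Proof.
by elim: d => [a|Y|d1 IH1 d2 IH2|d IH|[] d IH|Y d IH] /=;
  rewrite !(nb_nat, nb_cons, nb_cat, nb_nil) ?IH1 ?IH2 ?IH.
Qed.

Lemma nb_list A (e : A -> seq nat) s : (forall x, nb (e x)) -> nb (enc_list e s).
Proof.
move=> He; rewrite /enc_list nb_cons nb_cat andbT /=.
by elim: s => //= x s IH; rewrite nb_cat He.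
Qed.

Lemma nb_triple p : nb (enc_triple p).
Proof. by rewrite /enc_triple !(nb_nat, nb_cat). Qed.

Lemma nb_m psi : nb (enc_m psi).
Proof.
elim: psi => [j d|X|a IHa b IHb|a IH|D a IH|X a IH].
- by rewrite /= nb_cons nb_cat nb_nat nb_t.
- by rewrite /= nb_cons nb_nat.
- by rewrite /= nb_cons nb_cat IHa IHb.
- by rewrite /= nb_cons IH.
- rewrite -[enc_m _]/(17 :: (enc_list enc_t D ++ enc_m a)) nb_cons nb_cat IH nb_list //.
  exact: nb_t.
- by rewrite /= nb_cons nb_cat nb_nat IH.
Qed.

Lemma nb_minst y : nb (enc_minst y).
Proof.
case: y => [[qs psi] P]; rewrite /enc_minst /= nb_cat nb_cat nb_m.
apply/andP; split.
  by rewrite /enc_quants nb_cat; apply/andP; split=> //; elim: qs => // -[] qs IH;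
    rewrite /= nb_cons IH.
rewrite /enc_pds nb_cons !(nb_nat, nb_cat) !nb_list //.
- exact: nb_nat.
- by move=> l; apply: nb_list; apply: nb_nat.
- exact: nb_triple.
- exact: nb_triple.
- by move=> p; rewrite /enc_pair nb_cat !nb_nat.
- exact: nb_nat.
Qed.

Lemma size_enc_nat n : 0 < size (enc_nat n).
Proof. by rewrite size_cat addn1. Qed.

Lemma size_enc_t d : 0 < size (enc_t d).
Proof. by case: d. Qed.

Lemma size_enc_dbl_t d : size (enc_t (dbl_t d)) <= 2 * size (enc_t d).
Proof.
elim: d => [a|Y|d1 IH1 d2 IH2|d IH|[] d IH|Y d IH].
- rewrite [enc_t _]/= enc_nat_odd /=; lia.
all: rewrite /= ?size_cat /=; lia.
Qed.

(** * The reduction program *)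

Definition Adv : cmd := Wr 0 (inr 0) DR.

Definition Num (t : nat) : cmd := Seq (While 0 [:: 1; 2] (Copy t)) (Copy t).

Definition DblNum (t : nat) : cmd := Seq (If 0 [:: 3] Skip (Emit t [:: 1])) (Num t).

Definition OddNum (t : nat) : cmd := Seq (Emit t [:: 2]) (Num t).

(* Tapes: 0 is the input, 1 holds a translated trace formula or a state that has
   to be copied several times, 2 a unary counter, 3 a unary counter and later a
   buffer for call and return transitions, 4 the output. *)

Definition NodeCase : cmd :=
  If 0 [:: 4] (Seq (Copy 1) (OddNum 1))
  (If 0 [:: 5] (Seq (Copy 1) (Num 1))
  (If 0 [:: 6] (Seq (Copy 1) (Emit 2 [:: 1; 1]))
  (If 0 [:: 7] (Seq (Copy 1) (Emit 2 [:: 1]))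
  (If 0 [:: 8]
    (Seq (Copy 1) (Seq (If 0 [:: 11] (Copy 1) (Seq (Copy 1) (Emit 1 [:: 8; 9])))
      (Emit 2 [:: 1])))
    (Seq (Copy 1) (Seq (Num 1) (Emit 2 [:: 1]))))))).

(** The counter head stands on the last unit. That unit is erased for the node being read,
    [NodeCase] adds one unit per immediate subformula, and the head returns to the last unit. *)
Definition Node : cmd :=
  Seq (Wr 2 (inl 0) DS) (Seq NodeCase (Wr 2 (inr 2) DL)).

Definition Nodes : cmd := While 2 [:: 1] Node.

(* In prefix notation the end of a formula is found by counting the subformulae
   that are still to be read. *)
Definition Parse : cmd :=
  Seq (Emit 2 [:: 1]) (Seq (Wr 2 (inr 2) DL) (Seq Nodes (Wr 2 (inr 2) DR))).

(** The emitted symbols are the prefix code of [tor (change_t d)], cut at the four occurrences of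
    [dbl_t d]; [6], [7] and [8; 9] stand for disjunction, negation and the [Fg] step. *)
Definition Delta : cmd :=
  Seq Parse
  (Seq (Emit 4 [:: 6; 6; 7; 6]) (Seq (Transfer 1 4 Skip)
  (Seq (Emit 4 [:: 7; 8; 9; 8; 9]) (Seq (Transfer 1 4 Skip)
  (Seq (Emit 4 [:: 7; 6; 7]) (Seq (Transfer 1 4 Skip)
  (Seq (Emit 4 [:: 8; 9; 8; 9]) (Seq (Transfer 1 4 Skip) (Clear 1))))))))).

(** The unit on tape 3 counts the entries of the assignment, since the second mumbling step needs
    one [tap 0], coded [4; 3], for each of them. *)
Definition Gamma : cmd :=
  Seq Adv (Seq (Emit 3 [:: 1]) (Seq (Emit 4 [:: 7; 6; 4; 3; 7])
  (Seq (While 0 [:: 4; 5; 6; 7; 8; 12] Delta) (Seq Adv (Emit 4 [:: 4; 3]))))).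

Definition Drain : cmd :=
  Seq (Wr 3 (inr 3) DL) (While 3 [:: 1] (Seq (Wr 3 (inl 0) DL) (Emit 4 [:: 4; 3]))).

Definition Psi : cmd :=
  While 0 [:: 13; 14; 15; 16; 17; 18]
  (If 0 [:: 13]
    (Seq (Copy 4) (Seq (Num 4) (Seq (Emit 4 [:: 8; 9]) (Seq Parse (Seq (Transfer 1 4 Skip) (Clear 1))))))
  (If 0 [:: 14; 18] (Seq (Copy 4) (Num 4))
  (If 0 [:: 15; 16] (Copy 4)
    (Seq (Copy 4) (Seq (Copy 4) (Seq (While 0 [:: 19] Gamma) (Seq (Copy 4)
    (Seq (Emit 4 [:: 17; 19]) (Seq Drain (Emit 4 [:: 20])))))))))).

Definition TransferDbl : cmd := Transfer 1 4 (If 1 [:: 3] Skip (Emit 4 [:: 1])).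

Definition SrcEdge : cmd :=
  Seq (Num 1) (Seq TransferDbl (Seq (Emit 4 [:: 2]) (Transfer 1 4 Skip))).

Definition digits : seq nat := [:: 1; 2; 3].

Definition IntEdge : cmd :=
  Seq SrcEdge (Seq (Emit 4 [:: 2]) (Seq (Transfer 1 4 Skip) (Seq (Clear 1) (DblNum 4)))).

(** One input triple contributes to two output lists. The internal edge is printed at once, while
    the call transition waits on tape 3 until the list of internal edges is complete. *)
Definition CallEdge : cmd :=
  Seq SrcEdge (Seq (Emit 3 [:: 2]) (Seq (Transfer 1 3 Skip) (Seq (Clear 1)
  (Seq (DblNum 3) (Num 3))))).

Definition RetEdge : cmd :=
  Seq SrcEdge (Seq (Emit 3 [:: 2]) (Seq (Transfer 1 3 Skip) (Seq (Clear 1)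
  (Seq (Num 3) (DblNum 3))))).

Definition ListOf (t : nat) (p : seq nat) (body : cmd) : cmd :=
  Seq (Copy t) (Seq (While 0 p body) (Copy t)).

Definition Label : cmd :=
  Seq Adv (Seq (Emit 4 [:: 19; 3; 20; 19]) (Seq (While 0 digits (OddNum 4)) (Copy 4))).

(** [Adv] skips the bracket [20] that closes the internal transitions, because calls and returns
    still add edges to that list; it is emitted after them. *)
Definition System : cmd :=
  Seq (Copy 4) (Seq (DblNum 4) (Seq (Num 4) (Seq (ListOf 4 digits (DblNum 4))
  (Seq (Seq (Copy 4) (Seq (While 0 digits IntEdge) Adv))
  (Seq (ListOf 3 digits CallEdge) (Seq (ListOf 3 digits RetEdge)
  (Seq (Emit 4 [:: 20]) (Seq (Transfer 3 4 Skip)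
  (Seq (ListOf 4 [:: 19] Label) (ListOf 4 digits (OddNum 4))))))))))).

Definition Reduce : cmd :=
  Seq (While 0 [:: 21; 22] (Copy 4)) (Seq (Copy 4) (Seq Psi System)).

(** * Correctness of the program *)

Lemma exec_num t n s ms : t < size ms ->
  exec (5 * size (enc_nat n)) (Num t.+1) (enc_nat n ++ s) (map hld ms) s
    (map hld (appt ms t (enc_nat n))).
Proof.
rewrite /enc_nat; elim: (bits_fuel n n) (bits_fuel_digits n n) ms => [|x ds IH] /=.
  move=> _ ms lt; apply: leads_le.
    by apply: leads_seq; [exact: exec_while0|exact: exec_copy].
  by [].
case/andP => xd dds ms lt.
have x0 : x != 0 by move: xd; rewrite !inE => /orP[] /eqP ->.
have szm : t < size (appt ms t [:: x]) by rewrite size_appt.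
have {IH} H := IH dds _ szm.
rewrite appt_cat /= in H => l.
have step : leads 5 (While 0 [:: 1; 2] (Copy t.+1)) (x :: (ds ++ [:: 3]) ++ s) (map hld ms)
    (While 0 [:: 1; 2] (Copy t.+1)) ((ds ++ [:: 3]) ++ s) (map hld (appt ms t [:: x])).
  by apply: leads_while => //; apply: exec_copy.
have [t1 [l1 [tn1 r1]]] := step l; have [t2 [l2 [tn2 r2]]] := H l1.
exists (t1 + t2), l2; split; first lia.
by rewrite arun_cat (arun_seq (Copy t.+1) r1).
Qed.

Lemma head_enc_nat n s : (head 0 (enc_nat n ++ s) \in [:: 3]) = (n == 0).
Proof. by case: n => // n; rewrite /enc_nat /=; case: odd. Qed.

Lemma exec_dblnum t n s ms : t < size ms ->
  exec (5 * size (enc_nat n) + 4) (DblNum t.+1) (enc_nat n ++ s) (map hld ms) s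
    (map hld (appt ms t (enc_nat n.*2))).
Proof.
move=> lt; case: n => [|n]; apply: leads_le.
- apply: leads_seq; first by apply: exec_if_true; [|exact: leads_refl].
  exact: exec_num.
- by [].
- apply: leads_seq.
    apply: exec_if_false; first by rewrite /hd_at head_enc_nat.
    exact: exec_emit.
  have := @exec_num t n.+1 s (appt ms t [:: 1]).
  by rewrite size_appt // appt_cat enc_nat_double //; apply.
- rewrite /=; lia.
Qed.

Lemma exec_oddnum t n s ms : t < size ms ->
  exec (5 * size (enc_nat n) + 3) (OddNum t.+1) (enc_nat n ++ s) (map hld ms) s
    (map hld (appt ms t (enc_nat n.*2.+1))).
Proof.
move=> lt; apply: leads_le.
  apply: leads_seq; first exact: exec_emit.
  have := @exec_num t n s (appt ms t [:: 2]).
  by rewrite size_appt // appt_cat enc_nat_odd; apply.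
rewrite /=; lia.
Qed.

(** A unary counter with its head on the last unit, or on a blank when it is empty, so testing the
    head for [1] tests whether anything is pending. *)
Definition ctop (c : nat) : tape := (nseq c.-1 1, (0 < c : nat), [::]).

Lemma hld_nseq c : hld (nseq c 1) = (nseq c 1, 0, [::]).
Proof. by rewrite /hld rev_nseq. Qed.

Lemma amove_hld c : amove (hld (nseq c 1)) DL = ctop c.
Proof. by rewrite hld_nseq; case: c. Qed.

Lemma nodes_iter n inp inp' w w' b o c c' :
  exec n NodeCase inp (map hld [:: w; nseq c 1; b; o]) inp'
    (map hld [:: w'; nseq c' 1; b; o]) ->
  leads (n + 6) Nodes inp [:: hld w; ctop c.+1; hld b; hld o]
    Nodes inp' [:: hld w'; ctop c'; hld b; hld o].
Proof.
move=> H; apply: leads_le.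
  apply: leads_while => //.
  apply: leads_seq; first exact: exec_wr.
  rewrite /awrite /= -hld_nseq.
  apply: leads_seq; first exact: H.
  have := exec_mv_setz inp' [:: w'; nseq c' 1; b; o] (hld (nseq c' 1)) 1 DL.
  by rewrite amove_hld; apply.
lia.
Qed.

Lemma nseq_rcons c : nseq c 1 ++ [:: 1] = nseq c.+1 1.
Proof. by rewrite -[[:: 1]]/(nseq 1 1) -nseqD addn1. Qed.

(** One formula consumes exactly one unit, whatever number [c] of others is pending. Running from
    loop head to loop head lets the two parts of a disjunction be processed one after the other. *)
Lemma exec_nodes d s w b o c :
  leads (30 * size (enc_t d)) Nodes (enc_t d ++ s) [:: hld w; ctop c.+1; hld b; hld o]
    Nodes s [:: hld (w ++ enc_t (dbl_t d)); ctop c; hld b; hld o].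
Proof.
have cc1 := nseq_rcons.
have cc2 c' : nseq c' 1 ++ [:: 1; 1] = nseq c'.+2 1.
  by rewrite -[[:: 1; 1]]/(nseq 2 1) -nseqD addn2.
elim: d s w c => [a|Y|d1 IH1 d2 IH2|d IH|f d IH|Y d IH] s w c.
- apply: leads_le.
    apply: (nodes_iter (c' := c)); apply: exec_if_true => //; apply: leads_eqm.
      by apply: leads_seq; [apply: exec_copy|apply: exec_oddnum].
    by rewrite /appt /= -catA.
  have := size_enc_nat a; rewrite /=; lia.
- apply: leads_le.
    apply: (nodes_iter (c' := c)); apply: exec_if_false => //; apply: exec_if_true => //.
    apply: leads_eqm.
      by apply: leads_seq; [apply: exec_copy|apply: exec_num].
    by rewrite /appt /= -catA.
  have := size_enc_nat Y; rewrite /=; lia.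
- rewrite [enc_t (tor _ _)]/= cat_cons -catA; apply: leads_le.
    apply: leads_trans.
      apply: (nodes_iter (c' := c.+2) (w' := w ++ [:: 6])).
      do 2![apply: exec_if_false => //]; apply: exec_if_true => //; apply: leads_eqm.
        by apply: leads_seq; [apply: exec_copy|apply: exec_emit].
      by rewrite /appt /= cc2.
    by apply: leads_trans; [apply: IH1|apply: leads_eqm; [apply: IH2|rewrite /= -!catA]].
  rewrite /= size_cat; lia.
- apply: leads_le.
    apply: leads_trans.
      apply: (nodes_iter (c' := c.+1) (w' := w ++ [:: 7])).
      do 3![apply: exec_if_false => //]; apply: exec_if_true => //; apply: leads_eqm.
        by apply: leads_seq; [apply: exec_copy|apply: exec_emit].
      by rewrite /appt /= cc1.
    by apply: leads_eqm; [apply: IH|rewrite /= -!catA].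
  rewrite /=; lia.
- case: f.
  + apply: leads_le.
      apply: leads_trans.
        apply: (nodes_iter (c' := c.+1) (w' := w ++ [:: 8; 9; 8; 9])).
        do 4![apply: exec_if_false => //]; apply: exec_if_true => //; apply: leads_eqm.
          apply: leads_seq; first by apply: exec_copy.
          apply: leads_seq.
            apply: exec_if_false => //.
            by apply: leads_seq; [apply: exec_copy|apply: exec_emit].
          by apply: exec_emit.
        by rewrite /appt /= cc1 -!catA.
      by apply: leads_eqm; [apply: IH|rewrite /= -!catA].
    rewrite /=; lia.
  + apply: leads_le.
      apply: leads_trans.
        apply: (nodes_iter (c' := c.+1) (w' := w ++ [:: 8; 10; 8; 9])).
        do 4![apply: exec_if_false => //]; apply: exec_if_true => //; apply: leads_eqm.
          apply: leads_seq; first by apply: exec_copy.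
          apply: leads_seq.
            apply: exec_if_false => //.
            by apply: leads_seq; [apply: exec_copy|apply: exec_emit].
          by apply: exec_emit.
        by rewrite /appt /= cc1 -!catA.
      by apply: leads_eqm; [apply: IH|rewrite /= -!catA].
    rewrite /=; lia.
  + apply: leads_le.
      apply: leads_trans.
        apply: (nodes_iter (c' := c.+1) (w' := w ++ [:: 8; 11])).
        do 4![apply: exec_if_false => //]; apply: exec_if_true => //; apply: leads_eqm.
          apply: leads_seq; first by apply: exec_copy.
          apply: leads_seq; first by apply: exec_if_true => //; apply: exec_copy.
          by apply: exec_emit.
        by rewrite /appt /= cc1 -!catA.
      by apply: leads_eqm; [apply: IH|rewrite /= -!catA].
    rewrite /=; lia.
- rewrite [enc_t (tmu _ _)]/= cat_cons -catA; apply: leads_le.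
    apply: leads_trans.
      apply: (nodes_iter (c' := c.+1) (w' := w ++ 12 :: enc_nat Y)).
      do 5![apply: exec_if_false => //]; apply: leads_eqm.
        apply: leads_seq; first by apply: exec_copy.
        by apply: leads_seq; [apply: exec_num|apply: exec_emit].
      by rewrite /appt /= cc1 -!catA.
    by apply: leads_eqm; [apply: IH|rewrite /= -catA].
  rewrite /= size_cat; lia.
Qed.

Lemma exec_parse d s w b o :
  exec (30 * size (enc_t d) + 8) Parse (enc_t d ++ s) (map hld [:: w; [::]; b; o])
    s (map hld [:: w ++ enc_t (dbl_t d); [::]; b; o]).
Proof.
apply: leads_le.
  apply: leads_seq; first by apply: exec_emit.
  apply: leads_seq; first by apply: exec_wr.
  apply: leads_seq.
    apply: leads_trans; first exact: (exec_nodes d s w b o 0).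
    exact: exec_while0.
  by apply: leads_eqm; first exact: exec_wr.
rewrite /=; lia.
Qed.

(** Parsing, four transfers and clearing are each linear in the translated formula, at most twice as
    long as [d]; the fixed overhead is absorbed into the factor because the code of [d] is
    nonempty. *)
Lemma exec_delta d s b o :
  exec (250 * size (enc_t d)) Delta (enc_t d ++ s) (map hld [:: [::]; [::]; b; o])
    s (map hld [:: [::]; [::]; b; o ++ 6 :: enc_t (change_t d)]).
Proof.
have nbd := nb_t (dbl_t d).
apply: leads_le.
  apply: leads_eqm.
    apply: leads_seq; first exact: exec_parse.
    do 4![apply: leads_seq; first (by apply: exec_emit);
          apply: leads_seq; first by apply: exec_transfer0].
    by apply: exec_clear.
  by rewrite /appt /= -!catA.
have := size_enc_t d; have := size_enc_dbl_t d; rewrite /=; lia.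
Qed.

Lemma foldl_cat (A : Type) (e : A -> seq nat) o xs :
  foldl (fun o x => o ++ e x) o xs = o ++ flatten (map e xs).
Proof. by elim: xs o => [|x xs IH] o /=; rewrite ?cats0 // IH catA. Qed.

Lemma foldl_count (A : Type) (h : A -> seq nat) (xs : seq A) k o :
  foldl (fun x y => (x.1 ++ [:: 1], x.2 ++ h y)) (nseq k 1, o) xs =
  (nseq (k + size xs) 1, o ++ flatten (map h xs)).
Proof.
elim: xs k o => [|y xs IH] k o /=; first by rewrite addn0 cats0.
by rewrite nseq_rcons IH addnS addSn catA.
Qed.

Lemma enc_stutter g : enc_t (stutter_t g) =
  [:: 7; 6; 4; 3; 7] ++ flatten [seq 6 :: enc_t (change_t d) | d <- g] ++ [:: 4; 3].
Proof.
rewrite /stutter_t /=; do 5![congr (_ :: _)].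
by elim: g => //= d g ->; rewrite -!catA.
Qed.

Lemma exec_gamma g s b o :
  exec (300 * size (enc_list enc_t g)) Gamma (enc_list enc_t g ++ s)
    (map hld [:: [::]; [::]; b; o])
    s (map hld [:: [::]; [::]; b ++ [:: 1]; o ++ enc_t (stutter_t g)]).
Proof.
rewrite /enc_list cat_cons -catA; apply: leads_le.
  apply: leads_eqm.
    apply: leads_seq; first exact: exec_adv.
    do 2![apply: leads_seq; first by apply: exec_emit].
    apply: leads_seq; first apply: (exec_while_list (e := enc_t)
        (mm := fun o => map hld [:: [::]; [::]; b ++ [:: 1]; o])
        (f := fun o d => o ++ 6 :: enc_t (change_t d))) => //.
    - by move=> d; split; [exact: size_enc_t|move=> s'; case: d].
    - by move=> d o' s'; apply: exec_delta.
    apply: leads_seq; first exact: exec_adv.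
    by apply: exec_emit.
  by rewrite foldl_cat enc_stutter /appt /= -!catA.
rewrite /= size_cat /=; lia.
Qed.

Lemma exec_drain k s o :
  exec (8 * k + 4) Drain s (map hld [:: [::]; [::]; nseq k 1; o])
    s (map hld [:: [::]; [::]; [::]; o ++ flatten (nseq k [:: 4; 3])]).
Proof.
have loop : exec (8 * k + 1) (While 3 [:: 1] (Seq (Wr 3 (inl 0) DL) (Emit 4 [:: 4; 3])))
    s [:: hld [::]; hld [::]; ctop k; hld o]
    s (map hld [:: [::]; [::]; [::]; o ++ flatten (nseq k [:: 4; 3])]).
  elim: k o => [|k IH] o; first by rewrite cats0; apply: exec_while0.
  apply: leads_le.
    apply: leads_trans; last first.
      by have := IH (o ++ [:: 4; 3]); rewrite -catA; apply.
    apply: leads_while => //; apply: leads_seq; first exact: exec_wr.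
    have := @exec_emit_setz 2 3 [:: 4; 3] (ctop k) s [:: [::]; [::]; [::]; o].
    have -> : awrite [:: hld [::]; hld [::]; ctop k.+1; hld o] 2 0 DL =
        setz [:: [::]; [::]; [::]; o] 2 (ctop k) by case: k {IH}.
    by apply.
  rewrite /=; lia.
apply: leads_le.
  apply: leads_seq; last exact: loop.
  apply: leads_eqm; first exact: exec_wr.
  by rewrite -amove_hld /awrite /=.
lia.
Qed.

(** Stated from loop head to loop head with empty work tapes, so that subformulae follow each other
    in prefix order without a stack. *)
Lemma exec_psi psi s o :
  leads (400 * size (enc_s psi)) Psi (enc_s psi ++ s) (map hld [:: [::]; [::]; [::]; o])
    Psi s (map hld [:: [::]; [::]; [::]; o ++ enc_m (dbl_m psi)]).
Proof.
elim: psi s o => [j d|X|a IHa b IHb|a IH|G a IH|X a IH] s o.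
- have nbd := nb_t (dbl_t d).
  rewrite [enc_s _]/= cat_cons -catA; apply: leads_le.
    apply: leads_while => //; apply: exec_if_true => //; apply: leads_eqm.
      apply: leads_seq; first by apply: exec_copy.
      apply: leads_seq; first by apply: exec_num.
      apply: leads_seq; first by apply: exec_emit.
      apply: leads_seq; first exact: exec_parse.
      apply: leads_seq; first by apply: exec_transfer0.
      by apply: exec_clear.
    by rewrite /appt /= -4!catA.
  have := size_enc_t d; have := size_enc_dbl_t d; rewrite /= size_cat; lia.
- rewrite [enc_s _]/= cat_cons; apply: leads_le.
    apply: leads_while => //; apply: exec_if_false => //; apply: exec_if_true => //.
    apply: leads_eqm.
      by apply: leads_seq; [apply: exec_copy|apply: exec_num].
    by rewrite /appt /= -catA.
  rewrite /=; lia.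
- rewrite [enc_s _]/= cat_cons -catA; apply: leads_le.
    apply: leads_trans.
      apply: leads_while => //; do 2![apply: exec_if_false => //]; apply: exec_if_true => //.
      by apply: exec_copy.
    apply: leads_trans; first exact: IHa.
    by apply: leads_eqm; [apply: IHb|rewrite /= -!catA].
  rewrite /= size_cat; lia.
- apply: leads_le.
    apply: leads_trans.
      apply: leads_while => //; do 2![apply: exec_if_false => //]; apply: exec_if_true => //.
      by apply: exec_copy.
    by apply: leads_eqm; [apply: IH|rewrite /= -!catA].
  rewrite /=; lia.
- have -> : enc_s (snext G a) ++ s =
      17 :: 19 :: flatten (map (enc_list enc_t) G) ++ 20 :: enc_s a ++ s.
    by rewrite /= -!catA.
  apply: leads_le.
    apply: leads_trans.
      apply: leads_while => //; do 3![apply: exec_if_false => //].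
      apply: leads_seq; first by apply: exec_copy.
      apply: leads_seq; first by apply: exec_copy.
      apply: leads_seq.
        apply: (exec_while_list (e := enc_list enc_t)
          (mm := fun x => map hld [:: [::]; [::]; x.1; x.2])
          (f := fun x g => (x.1 ++ [:: 1], x.2 ++ enc_t (stutter_t g)))
          G ([::], (o ++ [:: 17]) ++ [:: 19])) => //.
        by move=> g [b o'] s'; apply: exec_gamma.
      rewrite (foldl_count (fun g => enc_t (stutter_t g)) _ 0).
      apply: leads_seq; first by apply: exec_copy.
      apply: leads_seq; first by apply: exec_emit.
      apply: leads_seq; first by apply: exec_drain.
      by apply: exec_emit.
    apply: leads_eqm; first exact: IH.
    rewrite /= map_nseq -map_comp -!catA.
    by [].
  (* Bounds the counter on tape 3, and with it the cost of [Drain], by the length of the code just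
     read. *)
  have : size G <= size (flatten (map (enc_list enc_t) G)).
    by elim: G {IH} => //= g G IH; rewrite size_cat; lia.
  by rewrite /= !size_cat /= ?size_cat /=; lia.
- rewrite [enc_s _]/= cat_cons -catA; apply: leads_le.
    apply: leads_trans.
      apply: leads_while => //; apply: exec_if_false => //; apply: exec_if_true => //.
      by apply: leads_seq; [apply: exec_copy|apply: exec_num].
    apply: leads_eqm; first exact: IH.
    by rewrite /appt /= -!catA.
  rewrite /= size_cat; lia.
Qed.

(** * Translating the pushdown system *)

Lemma enc_nat_digits n s : head 0 (enc_nat n ++ s) \in digits.
Proof. by case: n => // n; rewrite /enc_nat /=; case: odd. Qed.

Lemma enc_pairE a b : enc_pair (a, b) = enc_nat a ++ enc_nat b.
Proof. by []. Qed.

Lemma enc_tripleE a b c : enc_triple (a, b, c) = enc_nat a ++ enc_nat b ++ enc_nat c.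
Proof. by []. Qed.

Lemma exec_transfer_dbl n s b o :
  exec (8 * size (enc_nat n) + 11) TransferDbl s (map hld [:: enc_nat n; [::]; b; o])
    s (map hld [:: enc_nat n; [::]; b; o ++ enc_nat n.*2]).
Proof.
have nbn := nb_nat n; pose po := if n == 0 then [::] else [:: 1].
have -> : enc_nat n.*2 = po ++ enc_nat n.
  by rewrite /po; case: n {nbn po} => // n; rewrite enc_nat_double.
apply: leads_le.
  apply: (@exec_transfer 3 0 3 _ s [:: enc_nat n; [::]; b; o] _ po) => //=.
  have hdE := head_enc_nat n [::]; rewrite cats0 in hdE.
  apply: exec_if; rewrite /= hdE /po; case: eqP => _.
    by rewrite appt0 //; apply: leads_le; [apply: leads_refl|].
  have := @exec_emit_setz 0 3 [:: 1]
    ([::], head 0 (enc_nat n), behead (enc_nat n)) s [:: enc_nat n; [::]; b; o].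
  exact.
lia.
Qed.

Lemma exec_src_edge n s b o :
  exec (21 * size (enc_nat n) + 30) SrcEdge (enc_nat n ++ s) (map hld [:: [::]; [::]; b; o])
    s (map hld [:: enc_nat n; [::]; b; o ++ enc_pair (src_edge n)]).
Proof.
have nbn := nb_nat n; apply: leads_le.
  apply: leads_eqm.
    apply: leads_seq; first by apply: exec_num.
    apply: leads_seq; first exact: exec_transfer_dbl.
    apply: leads_seq; first by apply: exec_emit.
    by apply: exec_transfer0.
  rewrite /src_edge enc_pairE enc_nat_odd /appt /=.
  by move: (enc_nat n) (enc_nat n.*2) => x y; rewrite -!catA.
rewrite /=; lia.
Qed.

Lemma exec_int_edge r b o s :
  exec (100 * size (enc_pair r)) IntEdge (enc_pair r ++ s) (map hld [:: [::]; [::]; b; o])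
    s (map hld [:: [::]; [::]; b;
         o ++ (enc_pair (src_edge r.1) ++ enc_pair (r.1.*2.+1, r.2.*2))]).
Proof.
have nbn := nb_nat r.1; rewrite {1 2}/enc_pair -catA; apply: leads_le.
  apply: leads_eqm.
    apply: leads_seq; first exact: exec_src_edge.
    apply: leads_seq; first by apply: exec_emit.
    apply: leads_seq; first by apply: exec_transfer0.
    apply: leads_seq; first by apply: exec_clear.
    by apply: exec_dblnum.
  rewrite /src_edge !enc_pairE enc_nat_odd /appt /=.
  by move: (enc_nat r.1) (enc_nat r.1.*2) (enc_nat r.2.*2) => x y z; rewrite -!catA.
have := size_enc_nat r.1; have := size_enc_nat r.2; rewrite /= size_cat; lia.
Qed.

Lemma exec_call_edge r b o s :
  exec (100 * size (enc_triple r)) CallEdge (enc_triple r ++ s)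
    (map hld [:: [::]; [::]; b; o])
    s (map hld [:: [::]; [::]; b ++ enc_triple (r.1.1.*2.+1, r.1.2.*2, r.2);
         o ++ enc_pair (src_edge r.1.1)]).
Proof.
have nbn := nb_nat r.1.1; rewrite {1 2}/enc_triple -(catA (enc_nat r.1.1)) -(catA (enc_nat r.1.2)); apply: leads_le.
  apply: leads_eqm.
    apply: leads_seq; first exact: exec_src_edge.
    apply: leads_seq; first by apply: exec_emit.
    apply: leads_seq; first by apply: exec_transfer0.
    apply: leads_seq; first by apply: exec_clear.
    by apply: leads_seq; [apply: exec_dblnum|apply: exec_num].
  rewrite enc_tripleE enc_nat_odd /appt /=.
  by move: (enc_nat r.1.1) (enc_nat r.1.2.*2) (enc_nat r.2) => x y z; rewrite -!catA.
have := size_enc_nat r.1.1; have := size_enc_nat r.1.2; have := size_enc_nat r.2.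
rewrite /= !size_cat; lia.
Qed.

Lemma exec_ret_edge r b o s :
  exec (100 * size (enc_triple r)) RetEdge (enc_triple r ++ s)
    (map hld [:: [::]; [::]; b; o])
    s (map hld [:: [::]; [::]; b ++ enc_triple (r.1.1.*2.+1, r.1.2, r.2.*2);
         o ++ enc_pair (src_edge r.1.1)]).
Proof.
have nbn := nb_nat r.1.1; rewrite {1 2}/enc_triple -(catA (enc_nat r.1.1)) -(catA (enc_nat r.1.2)); apply: leads_le.
  apply: leads_eqm.
    apply: leads_seq; first exact: exec_src_edge.
    apply: leads_seq; first by apply: exec_emit.
    apply: leads_seq; first by apply: exec_transfer0.
    apply: leads_seq; first by apply: exec_clear.
    by apply: leads_seq; [apply: exec_num|apply: exec_dblnum].
  rewrite enc_tripleE enc_nat_odd /appt /=.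
  by move: (enc_nat r.1.1) (enc_nat r.1.2) (enc_nat r.2.*2) => x y z; rewrite -!catA.
have := size_enc_nat r.1.1; have := size_enc_nat r.1.2; have := size_enc_nat r.2.
rewrite /= !size_cat; lia.
Qed.

Lemma exec_while_pair (A : Type) (e fb fo : A -> seq nat) K p body xs s b o :
  (forall x, 0 < size (e x) /\ forall s, head 0 (e x ++ s) \in p) ->
  (forall x b o s, exec (K * size (e x)) body (e x ++ s) (map hld [:: [::]; [::]; b; o])
     s (map hld [:: [::]; [::]; b ++ fb x; o ++ fo x])) ->
  head 0 s \notin p ->
  exec ((K + 2) * size (flatten (map e xs)) + 1) (While 0 p body)
    (flatten (map e xs) ++ s) (map hld [:: [::]; [::]; b; o])
    s (map hld [:: [::]; [::]; b ++ flatten (map fb xs); o ++ flatten (map fo xs)]).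
Proof.
move=> He Hb hs; apply: leads_eqm.
  apply: (exec_while_list (mm := fun x => map hld [:: [::]; [::]; x.1; x.2])
    (f := fun x y => (x.1 ++ fb y, x.2 ++ fo y)) xs (b, o)) => //.
rewrite /=; have -> // : forall b o, foldl (fun x y => (x.1 ++ fb y, x.2 ++ fo y)) (b, o) xs =
    (b ++ flatten (map fb xs), o ++ flatten (map fo xs)).
by elim: xs => [|x xs IH] b' o' /=; rewrite ?cats0 // IH !catA.
Qed.

Lemma flatten_map_nil (A : Type) (xs : seq A) : flatten [seq [::] | _ <- xs] = [::] :> seq nat.
Proof. by elim: xs. Qed.

Lemma exec_list_out (A : Type) (e f : A -> seq nat) K p body xs s b o :
  (forall x, 0 < size (e x) /\ forall s, head 0 (e x ++ s) \in p) ->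
  (forall x b o s, exec (K * size (e x)) body (e x ++ s) (map hld [:: [::]; [::]; b; o])
     s (map hld [:: [::]; [::]; b; o ++ f x])) ->
  20 \notin p ->
  exec ((K + 10) * size (enc_list e xs)) (ListOf 4 p body) (enc_list e xs ++ s)
    (map hld [:: [::]; [::]; b; o])
    s (map hld [:: [::]; [::]; b; o ++ enc_list f xs]).
Proof.
move=> He Hb p20; rewrite /enc_list cat_cons -catA; apply: leads_le.
  apply: leads_eqm.
    apply: leads_seq; first by apply: exec_copy.
    apply: leads_seq.
      apply: (exec_while_pair (fb := fun=> [::]) (fo := f)) He _ _ => //.
      by move=> x b' o' s'; rewrite cats0; apply: Hb.
    by apply: exec_copy.
  by rewrite flatten_map_nil cats0 /appt /= -!catA.
rewrite /= size_cat /=; lia.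
Qed.

Lemma exec_list_buf (A : Type) (e fb fo : A -> seq nat) K p body xs s b o :
  (forall x, 0 < size (e x) /\ forall s, head 0 (e x ++ s) \in p) ->
  (forall x b o s, exec (K * size (e x)) body (e x ++ s) (map hld [:: [::]; [::]; b; o])
     s (map hld [:: [::]; [::]; b ++ fb x; o ++ fo x])) ->
  20 \notin p ->
  exec ((K + 10) * size (enc_list e xs)) (ListOf 3 p body) (enc_list e xs ++ s)
    (map hld [:: [::]; [::]; b; o])
    s (map hld [:: [::]; [::]; b ++ enc_list fb xs; o ++ flatten (map fo xs)]).
Proof.
move=> He Hb p20; rewrite /enc_list cat_cons -catA; apply: leads_le.
  apply: leads_eqm.
    apply: leads_seq; first by apply: exec_copy.
    apply: leads_seq; first by apply: exec_while_pair He Hb _.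
    by apply: exec_copy.
  by rewrite /appt /= -!catA.
rewrite /= size_cat /=; lia.
Qed.

Lemma enc_nat_head n : 0 < size (enc_nat n) /\ forall s, head 0 (enc_nat n ++ s) \in digits.
Proof. by split=> [|s]; [apply: size_enc_nat|apply: enc_nat_digits]. Qed.

Lemma enc_pair_head r : 0 < size (enc_pair r) /\ forall s, head 0 (enc_pair r ++ s) \in digits.
Proof.
split=> [|s]; last by rewrite /enc_pair -catA enc_nat_digits.
by rewrite size_cat ltn_addr // size_enc_nat.
Qed.

Lemma enc_triple_head r :
  0 < size (enc_triple r) /\ forall s, head 0 (enc_triple r ++ s) \in digits.
Proof.
split=> [|s]; last by rewrite /enc_triple -(catA (enc_nat r.1.1)) enc_nat_digits.
by rewrite size_cat ltn_addr // size_enc_nat.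
Qed.

Lemma exec_label l b o s :
  exec (50 * size (enc_list enc_nat l)) Label (enc_list enc_nat l ++ s)
    (map hld [:: [::]; [::]; b; o])
    s (map hld [:: [::]; [::]; b;
         o ++ enc_list enc_nat [:: 0] ++ enc_list enc_nat [seq a.*2.+1 | a <- l]]).
Proof.
rewrite {1 2}/enc_list cat_cons -catA; apply: leads_le.
  apply: leads_eqm.
    apply: leads_seq; first exact: exec_adv.
    apply: leads_seq; first by apply: exec_emit.
    apply: leads_seq.
      apply: (exec_while_pair (K := 8) (fb := fun=> [::]) (fo := fun a => enc_nat a.*2.+1))
          enc_nat_head _ _ => // n b' o' s'.
      rewrite cats0; apply: leads_le.
        by apply: leads_eqm; [apply: exec_oddnum|].
      by have := size_enc_nat n; lia.
    by apply: exec_copy.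
  rewrite flatten_map_nil cats0 /appt /=.
  by rewrite /enc_list -map_comp -!catA.
rewrite /= size_cat /=; lia.
Qed.

Lemma flatten_map_flatten (A B : Type) (e : B -> seq nat) (g : A -> seq B) xs :
  flatten (map e (flatten (map g xs))) = flatten [seq flatten (map e (g x)) | x <- xs].
Proof. by elim: xs => //= x xs IH; rewrite map_cat flatten_cat IH. Qed.

Lemma enc_list_map (A B : Type) (e : B -> seq nat) (g : A -> B) xs :
  enc_list e (map g xs) = enc_list (e \o g) xs.
Proof. by rewrite /enc_list -map_comp. Qed.

Lemma cat_enc_list (A : Type) (e : A -> seq nat) xs s :
  enc_list e xs ++ s = 19 :: flatten (map e xs) ++ 20 :: s.
Proof. by rewrite /enc_list cat_cons -catA. Qed.

Lemma enc_dbl_pint P : enc_list enc_pair (pint (dbl_pds P)) =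
  19 :: flatten [seq enc_pair (src_edge r.1) ++ enc_pair (r.1.*2.+1, r.2.*2) | r <- pint P]
  ++ flatten [seq enc_pair (src_edge r.1.1) | r <- pcall P]
  ++ flatten [seq enc_pair (src_edge r.1.1) | r <- pret P] ++ [:: 20].
Proof.
rewrite /enc_list /= !map_cat !flatten_cat flatten_map_flatten -!map_comp -!(catA (flatten _)).
by congr (19 :: flatten _ ++ _); apply: eq_map => r; rewrite /= cats0.
Qed.

Lemma enc_dbl_plab P : enc_list (enc_list enc_nat) (plab (dbl_pds P)) =
  enc_list (fun l => enc_list enc_nat [:: 0] ++ enc_list enc_nat [seq a.*2.+1 | a <- l]) (plab P).
Proof.
rewrite /enc_list flatten_map_flatten; congr (19 :: flatten _ ++ _).
by apply: eq_map => l /=; rewrite cats0.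
Qed.

Lemma size_enc_double n : size (enc_nat n.*2) <= (size (enc_nat n)).+1.
Proof. by case: n => // n; rewrite enc_nat_double. Qed.

Lemma size_enc_list_le (A : Type) (e f : A -> seq nat) k xs :
  (forall x, size (f x) <= k * size (e x)) -> 0 < k ->
  size (enc_list f xs) <= k * size (enc_list e xs).
Proof.
move=> ef k0; rewrite /enc_list /= !size_cat /=.
have : size (flatten (map f xs)) <= k * size (flatten (map e xs)).
  by elim: xs => //= x xs IH; rewrite !size_cat mulnDr leq_add.
nia.
Qed.

#[local] Arguments enc_list : simpl never.

Lemma exec_system P o : exists b,
  exec (200 * size (enc_pds P)) System (enc_pds P) (map hld [:: [::]; [::]; [::]; o])
    [::] (map hld [:: [::]; [::]; b; o ++ enc_pds (dbl_pds P)]).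
Proof.
exists (enc_list enc_triple (pcall (dbl_pds P)) ++ enc_list enc_triple (pret (dbl_pds P))).
have nbb : nb (enc_list (fun r => enc_triple (r.1.1.*2.+1, r.1.2.*2, r.2)) (pcall P) ++
    enc_list (fun r => enc_triple (r.1.1.*2.+1, r.1.2, r.2.*2)) (pret P)).
  by rewrite nb_cat !nb_list // => r; apply: nb_triple.
set B := enc_list _ _ ++ _ in nbb.
(* The buffer [B] is read back by one transfer, so its length must be linear too: two numbers of
   each triple gain at most one digit, and no code of a number is empty. *)
have szB : size B <= 2 * size (enc_list enc_triple (pcall P)) + 2 * size (enc_list enc_triple (pret P)).
  rewrite size_cat leq_add //; apply: size_enc_list_le => // r;
    rewrite enc_tripleE enc_nat_odd;
    have := size_enc_double r.1.2; have := size_enc_double r.2;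
    rewrite /enc_triple /enc_nat /= !size_cat /=; lia.
have -> : enc_pds P = 24 :: enc_nat (nst P) ++ enc_nat (nstk P) ++ enc_list enc_nat (pinit P)
   ++ 19 :: flatten (map enc_pair (pint P)) ++ 20 :: enc_list enc_triple (pcall P)
     ++ enc_list enc_triple (pret P) ++ enc_list (enc_list enc_nat) (plab P)
     ++ enc_list enc_nat (pfair P) ++ [::].
  by rewrite /enc_pds cats0 (cat_enc_list enc_pair).
apply: leads_le.
  apply: leads_eqm.
    apply: leads_seq; first by apply: exec_copy.
    apply: leads_seq; first by apply: exec_dblnum.
    apply: leads_seq; first by apply: exec_num.
    apply: leads_seq.
      apply: (exec_list_out (K := 9) (f := fun n => enc_nat n.*2)) enc_nat_head _ _ => //.
      move=> n b' o' s'; apply: leads_le.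
        by apply: leads_eqm; [apply: exec_dblnum|].
      by have := size_enc_nat n; lia.
    apply: leads_seq.
      apply: leads_seq; first by apply: exec_copy.
      apply: leads_seq.
        apply: (exec_while_pair (fb := fun=> [::])) enc_pair_head _ _ => //.
        by move=> r b' o' s'; rewrite cats0; apply: exec_int_edge.
      exact: exec_adv.
    apply: leads_seq.
      by apply: (exec_list_buf (fb := fun r => enc_triple (r.1.1.*2.+1, r.1.2.*2, r.2))
        (fo := fun r => enc_pair (src_edge r.1.1))) enc_triple_head exec_call_edge _.
    apply: leads_seq.
      by apply: (exec_list_buf (fb := fun r => enc_triple (r.1.1.*2.+1, r.1.2, r.2.*2))
        (fo := fun r => enc_pair (src_edge r.1.1))) enc_triple_head exec_ret_edge _.
    apply: leads_seq; first by apply: exec_emit.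
    rewrite flatten_map_nil; apply: leads_seq.
      by apply: (@exec_transfer0 2 3 _ _ B).
    apply: leads_seq.
      apply: (exec_list_out (e := enc_list enc_nat)) exec_label _ => //.
    apply: (exec_list_out (K := 8) (f := fun n => enc_nat n.*2.+1)) enc_nat_head _ _ => //.
    move=> n b' o' s'; apply: leads_le.
      by apply: leads_eqm; [apply: exec_oddnum|].
    by have := size_enc_nat n; lia.
  rewrite /enc_pds enc_dbl_pint enc_dbl_plab !enc_list_map /appt /=.
  by rewrite /B /enc_list; do !rewrite /= -!catA.
move: szB; rewrite /B /enc_list; do !rewrite /= !size_cat; rewrite /=; lia.
Qed.

Lemma exec_reduce x : exists b,
  exec (500 * size (enc_sinst x)) Reduce (enc_sinst x) (map hld [:: [::]; [::]; [::]; [::]])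
    [::] (map hld [:: [::]; [::]; b; enc_minst (dbl_inst x)]).
Proof.
case: x => -[qs psi] P; pose q b := [:: if b then 21 else 22].
have -> : enc_sinst (qs, psi, P) = flatten (map q qs) ++ 23 :: enc_s psi ++ enc_pds P.
  by rewrite /enc_sinst /enc_quants -catA; congr (_ ++ _); elim: qs => //= b qs ->.
have [b H] := exec_system P (([::] ++ flatten (map q qs)) ++ [:: 23] ++ enc_m (dbl_m psi)).
exists b; apply: leads_le.
  apply: leads_eqm.
    apply: leads_seq.
      apply: (exec_while_pair (K := 3) (fb := fun=> [::]) (fo := q)) => //.
      - by case; split.
      - by move=> [|] b' o' s'; rewrite cats0; apply: exec_copy.
    rewrite flatten_map_nil; apply: leads_seq; first by apply: exec_copy.
    apply: leads_seq.
      apply: leads_trans; first exact: exec_psi.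
      exact: exec_while0.
    by rewrite -!catA in H *; exact: H.
  rewrite /enc_minst /enc_quants /= -!catA; congr [:: _; _; _; hld _].
  by elim: qs {H} => //= c qs ->.
rewrite size_cat [size (23 :: _)]/= (size_cat (enc_s psi)); lia.
Qed.

(** * The reduction machine *)

Lemma trimmeds_refl m : trimmeds m m.
Proof.
split=> // i; exists 0, 0; case: (nth _ m i) => [[l h] r].
by rewrite !cats0.
Qed.

Lemma drop_blanks_nseq k s : drop_blanks (nseq k 0 ++ s) = drop_blanks s.
Proof. by elim: k. Qed.

Lemma drop_blanks_nb s s' : s != [::] -> nb s -> drop_blanks (s ++ s') = s ++ s'.
Proof. by case: s => // a s _; rewrite nb_cons => /andP[] /=; case: a. Qed.

Lemma nb_rev s : nb (rev s) = nb s.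
Proof. exact: all_rev. Qed.

Lemma tape_contents_trimmed t w : nb w -> trimmed t (hld w) -> tape_contents t = w.
Proof.
move=> nbw [j [k ->]]; rewrite /tape_contents /= rev_cat revK rev_nseq -catA drop_blanks_nseq.
(* The empty word is separate because it has no nonblank symbol at which [drop_blanks] could
   stop. *)
rewrite -[0 :: _]/(nseq k.+1 0); have [->|w0] := eqVneq w [::].
  by rewrite -[nseq _ _]cats0 drop_blanks_nseq.
rewrite drop_blanks_nb // rev_cat rev_nseq drop_blanks_nseq -[rev w]cats0.
by rewrite drop_blanks_nb ?cats0 ?revK ?nb_rev // -size_eq0 size_rev size_eq0.
Qed.

Lemma computes_in_exec k prog n w b s m :
  0 < k -> wf_cmd k.+1 prog -> size m = k ->
  nb w -> last blank_tape m = hld w ->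
  exec n prog b (nseq k blank_tape) s m ->
  exists2 t, t <= n & tm_computes_in (tm_of k.+1 prog) b t w.
Proof.
move=> k0 wp szm nbw lastm /(_ [::]) [t [l [tn run]]]; exists t => //.
have sz0 : size (([::], head 0 b, behead b) :: nseq k blank_tape) = k.+1 by rewrite /= size_nseq.
have [ts [[szts trm] _] runt] := tm_run_arun wp sz0 (mem_residuals _) (trimmeds_refl _) run.
exists (index Skip (residuals prog), ts); split.
  rewrite -runt /tm_init; congr (tm_run _ _ (_, _)).
  by case: (residuals_head prog) => r -> /=; rewrite eqxx.
split; last first.
  rewrite /tm_output /=; apply: tape_contents_trimmed => //.
  rewrite -lastm (last_nth blank_tape) -nth_last szts /= szm.
  by have := trm k; rewrite /= -{2}szm -(prednK k0) /= szm.
(* The machine halts in either case: an index out of range also decodes to [Skip], the default of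
   [nth]. *)
rewrite /tm_step /=; case: (boolP (Skip \in residuals prog)) => [S|/memNindex ->].
  by rewrite nth_index.
by rewrite nth_default.
Qed.

Theorem theorem6p1 :
  (* fair pushdown model checking: stuttering H_mu <=_lin mumbling H_mu *)
  lin_time_reduction (fun _ => True) (fun _ => True) /\
  (* fair finite state model checking: stuttering H_mu <=_lin mumbling H_mu *)
  lin_time_reduction (fun x => is_kripke x.2) (fun y => is_kripke y.2).
Proof.
(* One machine serves both claims. Doubling adds internal edges only, so it maps Kripke structures
   to Kripke structures. *)
have reduction (pre : sinst -> Prop) (post : minst -> Prop) :
    (forall x, pre x -> post (dbl_inst x)) -> lin_time_reduction pre post.
  move=> prepost; exists (tm_of 5 Reduce), 500; split; first exact: wf_tm_of.
  move=> x xv /prepost post_y; have [b H] := exec_reduce x.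
  have [||||t tn run] := computes_in_exec (k := 4) _ _ _ (nb_minst (dbl_inst x)) _ H => //.
  exists t, (dbl_inst x); split; first lia.
  split=> //; split; first exact: dbl_inst_valid.
  by split=> //; apply: dbl_inst_holds.
split; apply: reduction => // x; exact: is_kripke_dbl.
Qed.
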